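(* For complex $a$ with $\operatorname{Re} a<0$ let $u(a)={}_3F_2\left(a,a+\tfrac13,a+\tfrac23;\tfrac13,\tfrac23;1\right)$. Then for every $a$ with $\operatorname{Re} a<0$ and $3a\notin\{-1,-2,-3,\dots\}$, $$u'(a)=3\sum_{j=0}^\infty\frac{(a)_j\left(a+\frac13\right)_j\left(a+\frac23\right)_j}{\left(\frac13\right)_j\left(\frac23\right)_j\,j!}\left[\psi(3(j+a))-\psi(3a)\right]=-3^{-3a/2-1}\left[\pi\sin\frac{\pi a}{2}+\cos\left(\frac{\pi a}{2}\right)\ln 27\right].$$
   Context: $(a)_n=\Gamma(a+n)/\Gamma(a)=a(a+1)\cdots(a+n-1)$ (with $(a)_0=1$) is the Pochhammer symbol, $\psi=\Gamma'/\Gamma$ is the digamma function, and ${}_3F_2(a,b,c;d,e;1)=\sum_{j=0}^\infty \frac{(a)_j(b)_j(c)_j}{(d)_j(e)_j\,j!}$, which converges when $\operatorname{Re}(d+e-a-b-c)>0$. For complex $s$, $3^{s}=e^{s\ln 3}$. *)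

(* Defs.v *)
From Stdlib Require Import Reals Factorial.
From Coquelicot Require Import Coquelicot.
Open Scope R_scope.
Open Scope C_scope.

(* Coquelicot's [Lim_seq] and [Series] are real-valued.  These complex versions
   are total: they are meaningful only when the sequence, resp. the series,
   converges. *)
Definition CLim_seq (v : nat -> C) : C :=
  (real (Lim_seq (fun n => Re (v n))), real (Lim_seq (fun n => Im (v n)))).

Definition CSeries (t : nat -> C) : C :=
  (Series (fun n => Re (t n)), Series (fun n => Im (t n))).

Definition Cexp (z : C) : C :=
  (exp (Re z) * cos (Im z), exp (Re z) * sin (Im z))%R.

Definition Ccos (z : C) : C := (Cexp (Ci * z) + Cexp (- (Ci * z))) / 2.

Definition Csin (z : C) : C := (Cexp (Ci * z) - Cexp (- (Ci * z))) / (2 * Ci).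

(* x ^ s for a real base x > 0. *)
Definition RCpower (x : R) (s : C) : C := Cexp (s * RtoC (ln x)).

Fixpoint pochhammer (a : C) (n : nat) : C :=
  match n with
  | O => 1
  | S m => pochhammer a m * (a + RtoC (INR m))
  end.

(* Euler's (Gauss's) limit n! n^z / (z (z+1) ... (z+n)), which defines the Gamma
   function at once on the whole complex plane minus {0, -1, -2, ...}; the
   values at the poles carry no meaning. *)
Definition CGamma (z : C) : C :=
  CLim_seq (fun n =>
    RtoC (INR (fact n)) * RCpower (INR n) z / pochhammer z (S n)).

Definition digamma (z : C) : C := C_derive CGamma z / CGamma z.

Definition term3F2 (a b c d e : C) (j : nat) : C :=
  (pochhammer a j * pochhammer b j * pochhammer c j)
  / (pochhammer d j * pochhammer e j * RtoC (INR (fact j))).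

(* 3F2(a, b, c; d, e; 1) *)
Definition hyp3F2 (a b c d e : C) : C := CSeries (term3F2 a b c d e).

Definition u_term (a : C) (j : nat) : C :=
  term3F2 a (a + 1 / 3) (a + 2 / 3) (1 / 3) (2 / 3) j.

Definition u (a : C) : C :=
  hyp3F2 a (a + 1 / 3) (a + 2 / 3) (1 / 3) (2 / 3).

Definition du_term (a : C) (j : nat) : C :=
  u_term a j * (digamma (3 * (RtoC (INR j) + a)) - digamma (3 * a)).

(* Main.v *)
Require Import Defs.
From Stdlib Require Import Reals Factorial Lra Lia.
From Coquelicot Require Import Coquelicot.
Open Scope R_scope.
Open Scope C_scope.

(** With [b = 3a], the [j]-th term of [u] is the coefficient of [x^(3j)] in [(1 - x)^(-b)].
    Summing the binomial series at the three cube roots of unity gives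
    [u(a) = (2/3) 3^(-3a/2) cos (pi a / 2)], the root [x = 1] contributing [0] because [Re b < 0].
    The second derivatives in [b] of the partial sums are bounded uniformly near a given point
    (Kummer's test), so the differentiated partial sums converge to the derivative of the
    closed form.  The same principle applied to Euler's limit shows that Gamma is differentiable
    away from its poles, so that [psi(z + n) - psi(z)] is the sum of the [1 / (z + k)], [k < n],
    which is the logarithmic derivative of the Pochhammer symbol. *)

(** All three cube roots of unity lie on the circle of convergence, beyond the reach of power series
    theory in the open disc. The partial sums at the two nontrivial roots are therefore followed
    along a path inside the closed disc, and writing [1 - x] as an exponential keeps the branch of
    [(1 - x)^(-b)] explicit. Since [1 - w = sqrt 3 * exp (- i pi / 6)] for [w = exp (2 i pi / 3)],
    these roots contribute [3^(-3a/2) exp (i pi a / 2)] and [3^(-3a/2) exp (- i pi a / 2)].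

    The derivative of [u] can be read off from the closed form; the work lies in proving that the
    termwise derivative converges to the same value. The coefficients have size [n^(Re b - 1)] and
    each logarithmic derivative costs only a factor [log n], so even two derivatives leave an
    absolutely summable series when [Re b < 0]. A uniform bound on second derivatives then replaces
    Cauchy's formula.

    As [digamma] is built from the total functions [CGamma] and [C_derive], its recurrence requires
    that Euler's limit really exist near the point, be differentiable there and not vanish. *)

(** * Elementary estimates for the complex modulus *)

Lemma RtoC_INR_S (n : nat) : RtoC (INR (S n)) = RtoC (INR n) + 1.
Proof. now rewrite S_INR, RtoC_plus. Qed.

Lemma im_le_Cmod (c : C) : (Rabs (Im c) <= Cmod c)%R.
Proof. exact (Rle_trans _ _ _ (Rmax_r _ _) (Rmax_Cmod c)). Qed.

Lemma Cmod_le_re_im (c : C) : (Cmod c <= Rabs (Re c) + Rabs (Im c))%R.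
Proof.
replace c with (RtoC (Re c) + Ci * RtoC (Im c)) at 1.
- eapply Rle_trans; [apply Cmod_triangle|].
  rewrite Cmod_mult, Cmod_Ci, !Cmod_R; lra.
- destruct c as [x y]; unfold Ci, RtoC, Cplus, Cmult; simpl; f_equal; ring.
Qed.

Lemma Cmod_sub_sym (x y : C) : Cmod (x - y) = Cmod (y - x).
Proof. rewrite <- Cmod_opp; f_equal; ring. Qed.

Lemma Cmod_triangle_inv (x y : C) : (Cmod x - Cmod y <= Cmod (x - y))%R.
Proof.
pose proof (Cmod_triangle (x - y) y) as H.
replace (x - y + y) with x in H by ring; lra.
Qed.

Lemma Cmod_le_trans (x y : C) : (Cmod x <= Cmod (x - y) + Cmod y)%R.
Proof. pose proof (Cmod_triangle_inv x y); lra. Qed.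

(** * Convergence of complex sequences *)

(** Stated through the real sequence of distances, so that squeezing and the real limit lemmas apply
    directly. *)
Definition cvg (u : nat -> C) (l : C) : Prop :=
  is_lim_seq (fun n => Cmod (u n - l)) 0.

Lemma is_lim_seq_0_le (u v : nat -> R) (N : nat) :
  (forall n, (N <= n)%nat -> 0 <= u n <= v n)%R ->
  is_lim_seq v 0 -> is_lim_seq u 0.
Proof.
intros H Hv.
apply (is_lim_seq_le_le_loc (fun _ => 0%R) u v); auto using is_lim_seq_const.
exists N; auto.
Qed.

Lemma cvg_squeeze (u : nat -> C) (l : C) (v : nat -> R) (N : nat) :
  (forall n, (N <= n)%nat -> Cmod (u n - l) <= v n)%R ->
  is_lim_seq v 0 -> cvg u l.
Proof.
intros H Hv; apply (is_lim_seq_0_le _ v N); auto.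
intros n Hn; split; [apply Cmod_ge_0|auto].
Qed.

Lemma cvg_ext_loc (u v : nat -> C) (l : C) (N : nat) :
  (forall n, (N <= n)%nat -> u n = v n) -> cvg u l -> cvg v l.
Proof.
intros H Hu; apply (cvg_squeeze v l (fun n => Cmod (u n - l)) N); auto.
intros n Hn; rewrite (H n Hn); lra.
Qed.

Lemma cvg_ext (u v : nat -> C) (l : C) :
  (forall n, u n = v n) -> cvg u l -> cvg v l.
Proof. intros H; apply (cvg_ext_loc _ _ _ 0); auto. Qed.

Lemma cvg_const (c : C) : cvg (fun _ => c) c.
Proof.
apply (is_lim_seq_ext (fun _ => 0%R)); [|apply is_lim_seq_const].
intros _; replace (c - c) with (RtoC 0) by ring; now rewrite Cmod_0.
Qed.

Lemma is_lim_seq_plus_0 (u v : nat -> R) :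
  is_lim_seq u 0 -> is_lim_seq v 0 -> is_lim_seq (fun n => u n + v n)%R 0.
Proof.
intros Hu Hv; replace 0%R with (0 + 0)%R by ring.
now apply is_lim_seq_plus'.
Qed.

Lemma is_lim_seq_scal_0 (u : nat -> R) (c : R) :
  is_lim_seq u 0 -> is_lim_seq (fun n => c * u n)%R 0.
Proof.
intros Hu; replace 0%R with (c * 0)%R by ring.
now apply (is_lim_seq_scal_l u c 0%R).
Qed.

Lemma cvg_plus (u v : nat -> C) (l m : C) :
  cvg u l -> cvg v m -> cvg (fun n => u n + v n) (l + m).
Proof.
intros Hu Hv.
apply (cvg_squeeze _ _ (fun n => Cmod (u n - l) + Cmod (v n - m))%R 0).
- intros n _; replace (u n + v n - (l + m)) with ((u n - l) + (v n - m)) by ring.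
  apply Cmod_triangle.
- now apply is_lim_seq_plus_0.
Qed.

Lemma cvg_mult (u v : nat -> C) (l m : C) :
  cvg u l -> cvg v m -> cvg (fun n => u n * v n) (l * m).
Proof.
intros Hu Hv.
apply (cvg_squeeze _ _ (fun n => Cmod (u n - l) * Cmod (v n - m)
   + (Cmod m * Cmod (u n - l) + Cmod l * Cmod (v n - m)))%R 0).
- intros n _.
  replace (u n * v n - l * m) with
    ((u n - l) * (v n - m) + (m * (u n - l) + l * (v n - m))) by ring.
  rewrite <- !Cmod_mult.
  eapply Rle_trans; [apply Cmod_triangle|apply Rplus_le_compat_l, Cmod_triangle].
- apply is_lim_seq_plus_0; [|apply is_lim_seq_plus_0; now apply is_lim_seq_scal_0].
  replace 0%R with (0 * 0)%R by ring.
  now apply is_lim_seq_mult'.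
Qed.

Lemma cvg_scal (u : nat -> C) (c l : C) :
  cvg u l -> cvg (fun n => c * u n) (c * l).
Proof. apply cvg_mult, cvg_const. Qed.

Lemma cvg_minus (u v : nat -> C) (l m : C) :
  cvg u l -> cvg v m -> cvg (fun n => u n - v n) (l - m).
Proof.
intros Hu Hv; apply (cvg_ext (fun n => u n + (- (1)) * v n)); [intros n; ring|].
replace (l - m) with (l + (- (1)) * m) by ring.
now apply cvg_plus, cvg_scal.
Qed.

Lemma cvg_Re (u : nat -> C) (l : C) :
  cvg u l -> is_lim_seq (fun n => Re (u n)) (Re l).
Proof.
intros H; apply is_lim_seq_spec; intros eps.
apply is_lim_seq_spec in H; destruct (H eps) as [N HN].
exists N; intros n Hn; specialize (HN n Hn).
rewrite Rminus_0_r, Rabs_pos_eq in HN by apply Cmod_ge_0.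
eapply Rle_lt_trans; [|exact HN].
exact (re_le_Cmod (u n - l)).
Qed.

Lemma cvg_Im (u : nat -> C) (l : C) :
  cvg u l -> is_lim_seq (fun n => Im (u n)) (Im l).
Proof.
intros H; apply is_lim_seq_spec; intros eps.
apply is_lim_seq_spec in H; destruct (H eps) as [N HN].
exists N; intros n Hn; specialize (HN n Hn).
rewrite Rminus_0_r, Rabs_pos_eq in HN by apply Cmod_ge_0.
eapply Rle_lt_trans; [|exact HN].
exact (im_le_Cmod (u n - l)).
Qed.

Lemma cvg_Re_Im (u : nat -> C) (x y : R) :
  is_lim_seq (fun n => Re (u n)) x -> is_lim_seq (fun n => Im (u n)) y ->
  cvg u (x, y).
Proof.
intros Hx Hy.
apply (cvg_squeeze _ _ (fun n => Rabs (Re (u n) - x) + Rabs (Im (u n) - y))%R 0).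
- intros n _; exact (Cmod_le_re_im (u n - (x, y))).
- apply is_lim_seq_plus_0; apply is_lim_seq_spec; intros eps.
  + apply is_lim_seq_spec in Hx; destruct (Hx eps) as [N HN]; exists N.
    intros n Hn; rewrite Rminus_0_r, Rabs_Rabsolu; now apply HN.
  + apply is_lim_seq_spec in Hy; destruct (Hy eps) as [N HN]; exists N.
    intros n Hn; rewrite Rminus_0_r, Rabs_Rabsolu; now apply HN.
Qed.

Lemma cvg_CLim_seq (u : nat -> C) (l : C) : cvg u l -> CLim_seq u = l.
Proof.
intros H; unfold CLim_seq.
rewrite (is_lim_seq_unique _ _ (cvg_Re _ _ H)), (is_lim_seq_unique _ _ (cvg_Im _ _ H)).
now destruct l.
Qed.

Lemma cvg_unique (u : nat -> C) (l m : C) : cvg u l -> cvg u m -> l = m.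
Proof. intros Hl Hm; rewrite <- (cvg_CLim_seq _ _ Hl); now apply cvg_CLim_seq. Qed.

Lemma cvg_Cmod_le (u : nat -> C) (l : C) (M : R) :
  cvg u l -> (forall n, Cmod (u n) <= M)%R -> (Cmod l <= M)%R.
Proof.
intros H HM; apply Rnot_lt_le; intros Hlt.
apply is_lim_seq_spec in H.
destruct (H (mkposreal (Cmod l - M) ltac:(lra))) as [N HN]; simpl in HN.
specialize (HN N (le_n N)).
rewrite Rminus_0_r, Rabs_pos_eq, Cmod_sub_sym in HN by apply Cmod_ge_0.
pose proof (Cmod_triangle_inv l (u N)); specialize (HM N); lra.
Qed.

Lemma cvg_subseq (u : nat -> C) (l : C) (phi : nat -> nat) :
  (forall n, (n <= phi n)%nat) -> cvg u l -> cvg (fun n => u (phi n)) l.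
Proof.
intros Hphi H; apply is_lim_seq_spec; intros eps.
apply is_lim_seq_spec in H; destruct (H eps) as [N HN]; exists N.
intros n Hn; apply HN; specialize (Hphi n); lia.
Qed.

Lemma cvg_incr_1 (u : nat -> C) (l : C) :
  cvg (fun n => u (S n)) l -> cvg u l.
Proof. intros H; now apply is_lim_seq_incr_1. Qed.

(** * Complex series *)

(** The upper bound is exclusive, so that [csum f (3 * n)] consists of exactly [n] blocks of three
    terms. Coquelicot's [sum_n] includes its bound, whence the shifts by [S] in the bridging
    lemmas. *)
Fixpoint csum (f : nat -> C) (n : nat) : C :=
  match n with O => 0 | S m => csum f m + f m end.

Lemma csum_ext (f g : nat -> C) (n : nat) :
  (forall k, (k < n)%nat -> f k = g k) -> csum f n = csum g n.
Proof.
induction n as [|n IH]; intros H; simpl; auto.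
rewrite IH, H; auto.
Qed.

Lemma csum_plus (f g : nat -> C) (n : nat) :
  csum (fun k => f k + g k) n = csum f n + csum g n.
Proof. induction n as [|n IH]; simpl; [|rewrite IH]; ring. Qed.

Lemma csum_scal (c : C) (f : nat -> C) (n : nat) :
  csum (fun k => c * f k) n = c * csum f n.
Proof. induction n as [|n IH]; simpl; [|rewrite IH]; ring. Qed.

Lemma csum_mod3 (f : nat -> C) (n : nat) :
  csum f (3 * n)
  = csum (fun j => f (3 * j)%nat + f (3 * j + 1)%nat + f (3 * j + 2)%nat) n.
Proof.
induction n as [|n IH]; [reflexivity|].
replace (3 * S n)%nat with (S (S (S (3 * n)))) by lia.
cbn [csum]; rewrite IH.
replace (3 * n + 1)%nat with (S (3 * n)) by lia.
replace (3 * n + 2)%nat with (S (S (3 * n))) by lia; ring.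
Qed.

Fixpoint rsum (f : nat -> R) (n : nat) : R :=
  match n with O => 0%R | S m => (rsum f m + f m)%R end.

Lemma Cmod_csum_le (f : nat -> C) (g : nat -> R) (n : nat) :
  (forall k, (k < n)%nat -> Cmod (f k) <= g k)%R ->
  (Cmod (csum f n) <= rsum g n)%R.
Proof.
induction n as [|n IH]; intros H; simpl; [rewrite Cmod_0; lra|].
eapply Rle_trans; [apply Cmod_triangle|].
apply Rplus_le_compat; auto.
Qed.

Lemma rsum_le (f g : nat -> R) (n : nat) :
  (forall k, (k < n)%nat -> f k <= g k)%R -> (rsum f n <= rsum g n)%R.
Proof.
induction n as [|n IH]; intros H; simpl; [lra|].
apply Rplus_le_compat; auto.
Qed.

Lemma rsum_scal (c : R) (f : nat -> R) (n : nat) :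
  rsum (fun k => c * f k)%R n = (c * rsum f n)%R.
Proof. induction n as [|n IH]; simpl; [|rewrite IH]; ring. Qed.

Lemma rsum_ge_0 (f : nat -> R) (n : nat) :
  (forall k, 0 <= f k)%R -> (0 <= rsum f n)%R.
Proof. intros H; induction n as [|n IH]; simpl; [lra|specialize (H n); lra]. Qed.

Lemma rsum_incr (f : nat -> R) (n m : nat) :
  (forall k, 0 <= f k)%R -> (n <= m)%nat -> (rsum f n <= rsum f m)%R.
Proof.
intros H; induction 1 as [|m _ IH]; simpl; [lra|specialize (H m); lra].
Qed.

Lemma csum_Re (f : nat -> C) (n : nat) :
  Re (csum f (S n)) = sum_n (fun k => Re (f k)) n.
Proof.
induction n as [|n IH].
- rewrite sum_O; simpl; unfold Re, Im; simpl; ring.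
- rewrite sum_Sn, <- IH; reflexivity.
Qed.

Lemma csum_Im (f : nat -> C) (n : nat) :
  Im (csum f (S n)) = sum_n (fun k => Im (f k)) n.
Proof.
induction n as [|n IH].
- rewrite sum_O; simpl; unfold Re, Im; simpl; ring.
- rewrite sum_Sn, <- IH; reflexivity.
Qed.

Lemma csum_sum_n (f : nat -> C) (n : nat) :
  csum f (S n) = sum_n (G := C_AbelianMonoid) f n.
Proof.
induction n as [|n IH].
- rewrite sum_O; apply Cplus_0_l.
- rewrite sum_Sn, <- IH; reflexivity.
Qed.

Lemma cvg_csum_S (f : nat -> C) (l : C) :
  cvg (csum f) l -> cvg (fun n => csum f (S n)) l.
Proof. apply (cvg_subseq (csum f) l S); auto. Qed.

Lemma cvg_CSeries (f : nat -> C) (l : C) : cvg (csum f) l -> CSeries f = l.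
Proof.
intros H; apply cvg_csum_S in H; unfold CSeries.
destruct l as [x y]; f_equal; apply is_series_unique.
- exact (is_lim_seq_ext _ _ (Finite x) (csum_Re f) (cvg_Re _ _ H)).
- exact (is_lim_seq_ext _ _ (Finite y) (csum_Im f) (cvg_Im _ _ H)).
Qed.

Lemma cvg_ex_series (f : nat -> C) (l : C) :
  cvg (csum f) l -> ex_series (K := C_AbsRing) (V := C_NormedModule) f.
Proof.
intros H; apply cvg_csum_S in H; exists l.
apply (filterlim_locally_ball_norm (K := C_AbsRing) (U := C_NormedModule)).
intros eps; apply is_lim_seq_spec in H; destruct (H eps) as [N HN]; exists N.
intros n Hn; specialize (HN n Hn); red.
rewrite Rminus_0_r, Rabs_pos_eq, csum_sum_n in HN by apply Cmod_ge_0.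
exact HN.
Qed.

(** The real and imaginary parts of the increments form series dominated by [v], and telescoping
    recovers the sequence. This yields limits whose value is not known in advance, such as those of
    Euler's products. *)
Lemma cvg_of_abs_summable (u : nat -> C) (v : nat -> R) (B : R) :
  (forall n, Cmod (u (S n) - u n) <= v n)%R ->
  (forall n, rsum v n <= B)%R ->
  exists l, cvg u l.
Proof.
intros Hu HB.
assert (Hv : forall n, (0 <= v n)%R).
{ intros n; eapply Rle_trans; [apply Cmod_ge_0|apply Hu]. }
assert (Hrs : forall n, sum_n v n = rsum v (S n)).
{ induction n as [|n IH]; [rewrite sum_O; simpl; ring|].
  rewrite sum_Sn, IH; reflexivity. }
assert (Hex : ex_series v).
{ assert (HL : ex_finite_lim_seq (sum_n v)).
  { apply (ex_finite_lim_seq_incr (sum_n v) B).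
    - intros n; rewrite sum_Sn; specialize (Hv (S n)); unfold plus; simpl; lra.
    - intros n; rewrite Hrs; apply HB. }
  exact HL. }
assert (Hcomp : forall p : C -> R,
   (forall x y : C, (p x - p y)%R = p (x - y)) -> (forall x, Rabs (p x) <= Cmod x)%R ->
   exists l : R, is_lim_seq (fun n => p (u n)) l).
{ intros p Hsub Hle.
  assert (Hs : ex_series (fun n => p (u (S n)) - p (u n))%R).
  { apply (ex_series_le (V := R_CompleteNormedModule) _ v); auto.
    intros n; rewrite Hsub; eapply Rle_trans; [apply Hle|apply Hu]. }
  destruct Hs as [l Hl]; exists (l + p (u 0%nat))%R.
  apply is_lim_seq_incr_1.
  apply (is_lim_seq_ext (fun n => sum_n (fun n => p (u (S n)) - p (u n)) n + p (u 0%nat))%R).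
  - induction n as [|n IH]; [rewrite sum_O; ring|].
    rewrite sum_Sn; unfold plus; simpl; simpl in IH; lra.
  - apply is_lim_seq_plus'; [exact Hl|apply is_lim_seq_const]. }
destruct (Hcomp Re) as [x Hx]; [intros [? ?] [? ?]; reflexivity|apply re_le_Cmod|].
destruct (Hcomp Im) as [y Hy]; [intros [? ?] [? ?]; reflexivity|apply im_le_Cmod|].
exists (x, y); now apply cvg_Re_Im.
Qed.

(** * Complex derivatives *)

(** An epsilon-delta form with the increment written out; [cderiv_is_derive] converts it to
    Coquelicot's notion. *)
Definition cderiv (f : C -> C) (x l : C) : Prop :=
  forall eps : R, (0 < eps)%R -> exists d : R, (0 < d)%R /\
    forall y : C, (Cmod (y - x) < d ->
      Cmod (f y - f x - (y - x) * l) <= eps * Cmod (y - x))%R.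

Lemma cderiv_is_derive (f : C -> C) (x l : C) :
  cderiv f x l -> is_derive (K := C_AbsRing) (V := C_NormedModule) f x l.
Proof.
intros H; split.
- apply (is_linear_scal_l (K := C_AbsRing) (V := C_NormedModule)).
- intros x0 Hx0 eps.
  apply (is_filter_lim_locally_unique (V := AbsRing_NormedModule C_AbsRing)) in Hx0.
  subst x0.
  destruct (H eps (cond_pos eps)) as [d [Hd Hd']].
  exists (mkposreal d Hd); intros y Hy; exact (Hd' y Hy).
Qed.

Lemma cderiv_quadratic (f : C -> C) (x l : C) (r K : R) :
  (0 < r)%R ->
  (forall y, Cmod (y - x) < r ->
     Cmod (f y - f x - (y - x) * l)%C <= K * (Cmod (y - x))²)%R ->
  cderiv f x l.
Proof.
intros Hr H eps Heps.
(* [Rabs K + 1] is positive whatever the sign of [K]. *)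
exists (Rmin r (eps / (Rabs K + 1)))%R.
assert (HK : (0 < Rabs K + 1)%R) by (pose proof (Rabs_pos K); lra).
split; [apply Rmin_pos; auto; now apply Rdiv_lt_0_compat|].
intros y Hy.
eapply Rle_trans; [apply H; eapply Rlt_le_trans; [exact Hy|apply Rmin_l]|].
assert (Hy2 : (Cmod (y - x) < eps / (Rabs K + 1))%R)
  by (eapply Rlt_le_trans; [exact Hy|apply Rmin_r]).
apply Rlt_div_r in Hy2; auto.
pose proof (Cmod_ge_0 (y - x)); pose proof (Rle_abs K); unfold Rsqr; nra.
Qed.

Lemma cderiv_bound (f : C -> C) (x l : C) : cderiv f x l ->
  exists d : R, (0 < d)%R /\ forall y : C, (Cmod (y - x) < d ->
    Cmod (f y - f x)%C <= (Cmod l + 1) * Cmod (y - x))%R.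
Proof.
intros H; destruct (H 1%R Rlt_0_1) as [d [Hd Hd']]; exists d; split; auto.
intros y Hy; eapply Rle_trans; [apply (Cmod_le_trans _ ((y - x) * l))|].
rewrite Cmod_mult; specialize (Hd' y Hy); lra.
Qed.

Lemma cderiv_ext_loc (f g : C -> C) (x l : C) (r : R) :
  (0 < r)%R -> (forall y, (Cmod (y - x) < r)%R -> f y = g y) ->
  cderiv f x l -> cderiv g x l.
Proof.
intros Hr Hfg H eps Heps; destruct (H eps Heps) as [d [Hd Hd']].
exists (Rmin r d); split; [now apply Rmin_pos|].
intros y Hy.
assert (Hx : (Cmod (x - x) < r)%R)
  by (replace (x - x) with (RtoC 0) by ring; now rewrite Cmod_0).
rewrite <- !Hfg; auto.
- apply Hd'; eapply Rlt_le_trans; [exact Hy|apply Rmin_r].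
- eapply Rlt_le_trans; [exact Hy|apply Rmin_l].
Qed.

Lemma cderiv_ext (f g : C -> C) (x l : C) :
  (forall y, f y = g y) -> cderiv f x l -> cderiv g x l.
Proof. intros H; apply (cderiv_ext_loc _ _ _ _ 1); auto; lra. Qed.

Lemma cderiv_const (c x : C) : cderiv (fun _ => c) x 0.
Proof.
apply (cderiv_quadratic _ _ _ 1 0); [lra|]; intros y _.
replace (c - c - (y - x) * 0) with (RtoC 0) by ring; rewrite Cmod_0; lra.
Qed.

Lemma cderiv_id (x : C) : cderiv (fun y => y) x 1.
Proof.
apply (cderiv_quadratic _ _ _ 1 0); [lra|]; intros y _.
replace (y - x - (y - x) * 1) with (RtoC 0) by ring; rewrite Cmod_0; lra.
Qed.

Lemma cderiv_plus (f g : C -> C) (x l m : C) :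
  cderiv f x l -> cderiv g x m -> cderiv (fun y => f y + g y) x (l + m).
Proof.
intros Hf Hg eps Heps.
destruct (Hf (eps / 2)%R ltac:(lra)) as [d1 [Hd1 H1]].
destruct (Hg (eps / 2)%R ltac:(lra)) as [d2 [Hd2 H2]].
exists (Rmin d1 d2); split; [now apply Rmin_pos|]; intros y Hy.
specialize (H1 y (Rlt_le_trans _ _ _ Hy (Rmin_l _ _))).
specialize (H2 y (Rlt_le_trans _ _ _ Hy (Rmin_r _ _))).
replace (f y + g y - (f x + g x) - (y - x) * (l + m)) with
  ((f y - f x - (y - x) * l) + (g y - g x - (y - x) * m)) by ring.
eapply Rle_trans; [apply Cmod_triangle|lra].
Qed.

Lemma cderiv_mult (f g : C -> C) (x l m : C) :
  cderiv f x l -> cderiv g x m ->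
  cderiv (fun y => f y * g y) x (l * g x + f x * m).
Proof.
intros Hf Hg eps Heps.
pose proof (Cmod_ge_0 (f x)) as Fp; pose proof (Cmod_ge_0 (g x)) as Gp.
pose proof (Cmod_ge_0 l) as Lp; pose proof (Cmod_ge_0 m) as Mp.
set (A := (Cmod (f x) + Cmod (g x) + 1)%R).
set (B := ((Cmod l + 1) * (Cmod m + 1))%R).
assert (HA : (0 < A)%R) by (unfold A; lra).
assert (HB : (0 < B)%R) by (unfold B; nra).
assert (HeA : (0 < eps / (2 * A))%R) by (apply Rdiv_lt_0_compat; lra).
assert (HeB : (0 < eps / (2 * B))%R) by (apply Rdiv_lt_0_compat; lra).
destruct (Hf _ HeA) as [d1 [Hd1 H1]].
destruct (Hg _ HeA) as [d2 [Hd2 H2]].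
destruct (cderiv_bound _ _ _ Hf) as [d3 [Hd3 H3]].
destruct (cderiv_bound _ _ _ Hg) as [d4 [Hd4 H4]].
exists (Rmin (Rmin (Rmin d1 d2) (Rmin d3 d4)) (eps / (2 * B))); split.
{ repeat apply Rmin_pos; auto. }
intros y Hy.
assert (Hy1 := Rlt_le_trans _ _ _ Hy (Rmin_l _ _)).
assert (Hy2 := Rlt_le_trans _ _ _ Hy (Rmin_r _ _)).
assert (Hy3 := Rlt_le_trans _ _ _ Hy1 (Rmin_l _ _)).
assert (Hy4 := Rlt_le_trans _ _ _ Hy1 (Rmin_r _ _)).
specialize (H1 y (Rlt_le_trans _ _ _ Hy3 (Rmin_l _ _))).
specialize (H2 y (Rlt_le_trans _ _ _ Hy3 (Rmin_r _ _))).
specialize (H3 y (Rlt_le_trans _ _ _ Hy4 (Rmin_l _ _))).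
specialize (H4 y (Rlt_le_trans _ _ _ Hy4 (Rmin_r _ _))).
(* Two first-order remainders plus the product of the increments, which is quadratic in [y - x];
   each group receives half of [eps]. *)
replace (f y * g y - f x * g x - (y - x) * (l * g x + f x * m)) with
  (((f y - f x - (y - x) * l) * g x + f x * (g y - g x - (y - x) * m))
   + (f y - f x) * (g y - g x)) by ring.
eapply Rle_trans; [apply Cmod_triangle|].
set (h := Cmod (y - x)) in *; assert (Hh : (0 <= h)%R) by apply Cmod_ge_0.
assert (Hquad : (Cmod ((f y - f x) * (g y - g x)) <= eps / 2 * h)%R).
{ rewrite Cmod_mult.
  apply Rle_trans with (((Cmod l + 1) * h) * ((Cmod m + 1) * h))%R.
  - apply Rmult_le_compat; auto using Cmod_ge_0.
  - replace ((Cmod l + 1) * h * ((Cmod m + 1) * h))%R with (B * h * h)%R by (unfold B; ring).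
    apply Rmult_le_compat_r; auto.
    replace (eps / 2)%R with (B * (eps / (2 * B)))%R by (field; lra).
    apply Rmult_le_compat_l; lra. }
assert (Hlin : (Cmod ((f y - f x - (y - x) * l) * g x
   + f x * (g y - g x - (y - x) * m)) <= eps / 2 * h)%R).
{ eapply Rle_trans; [apply Cmod_triangle|]; rewrite !Cmod_mult.
  replace (eps / 2 * h)%R with (eps / (2 * A) * h * A)%R by (field; lra).
  set (e := (eps / (2 * A) * h)%R) in *.
  assert (He : (0 <= e)%R) by (apply Rmult_le_pos; lra).
  unfold A; nra. }
lra.
Qed.

Lemma cderiv_scal (c : C) (f : C -> C) (x l : C) :
  cderiv f x l -> cderiv (fun y => c * f y) x (c * l).
Proof.
intros H; replace (c * l) with (0 * f x + c * l) by ring.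
apply (cderiv_mult (fun _ => c) f); auto using cderiv_const.
Qed.

Lemma cderiv_comp (f g : C -> C) (x l m : C) :
  cderiv f x l -> cderiv g (f x) m -> cderiv (fun y => g (f y)) x (l * m).
Proof.
intros Hf Hg eps Heps.
pose proof (Cmod_ge_0 l) as Lp; pose proof (Cmod_ge_0 m) as Mp.
destruct (cderiv_bound _ _ _ Hf) as [d1 [Hd1 H1]].
assert (HeA : (0 < eps / (2 * (Cmod l + 1)))%R) by (apply Rdiv_lt_0_compat; lra).
assert (HeB : (0 < eps / (2 * (Cmod m + 1)))%R) by (apply Rdiv_lt_0_compat; lra).
destruct (Hg _ HeA) as [d2 [Hd2 H2]].
destruct (Hf _ HeB) as [d3 [Hd3 H3]].
assert (Hd2' : (0 < d2 / (Cmod l + 1))%R) by (apply Rdiv_lt_0_compat; lra).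
exists (Rmin (Rmin d1 d3) (d2 / (Cmod l + 1))); split.
{ repeat apply Rmin_pos; auto. }
intros y Hy.
assert (Hy1 := Rlt_le_trans _ _ _ Hy (Rmin_l _ _)).
assert (Hy2 := Rlt_le_trans _ _ _ Hy (Rmin_r _ _)).
specialize (H1 y (Rlt_le_trans _ _ _ Hy1 (Rmin_l _ _))).
specialize (H3 y (Rlt_le_trans _ _ _ Hy1 (Rmin_r _ _))).
apply Rlt_div_r in Hy2; [|lra].
specialize (H2 (f y) ltac:(nra)).
replace (g (f y) - g (f x) - (y - x) * (l * m)) with
  ((g (f y) - g (f x) - (f y - f x) * m) + (f y - f x - (y - x) * l) * m) by ring.
eapply Rle_trans; [apply Cmod_triangle|]; rewrite Cmod_mult.
set (h := Cmod (y - x)) in *; assert (Hh : (0 <= h)%R) by apply Cmod_ge_0.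
assert (E1 : (eps / (2 * (Cmod l + 1)) * Cmod (f y - f x) <= eps / 2 * h)%R).
{ replace (eps / 2 * h)%R with (eps / (2 * (Cmod l + 1)) * ((Cmod l + 1) * h))%R
    by (field; lra).
  apply Rmult_le_compat_l; lra. }
assert (E2 : (Cmod (f y - f x - (y - x) * l) * Cmod m <= eps / 2 * h)%R).
{ replace (eps / 2 * h)%R with (eps / (2 * (Cmod m + 1)) * h * (Cmod m + 1))%R
    by (field; lra).
  apply Rmult_le_compat; auto using Cmod_ge_0; lra. }
lra.
Qed.

Lemma cderiv_inv (x : C) : x <> 0 -> cderiv Cinv x (- / (x * x)).
Proof.
intros Hx; assert (Hm : (0 < Cmod x)%R) by now apply Cmod_gt_0.
apply (cderiv_quadratic _ _ _ (Cmod x / 2) (2 / (Cmod x * Cmod x * Cmod x))%R); [lra|].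
intros y Hy.
assert (Hy2 : (Cmod x / 2 < Cmod y)%R).
{ pose proof (Cmod_triangle_inv x y); rewrite Cmod_sub_sym in Hy; lra. }
assert (Hy0 : y <> 0) by (apply Cmod_gt_0; lra).
replace (/ y - / x - (y - x) * - / (x * x)) with ((y - x) * (y - x) / (x * x * y))
  by (field; auto).
assert (Hxx : x * x <> 0) by (now apply Cmult_neq_0).
rewrite Cmod_div by (now apply Cmult_neq_0).
rewrite !Cmod_mult; unfold Rsqr, Rdiv; rewrite Rmult_comm.
apply Rmult_le_compat_r; [apply Rle_0_sqr|].
replace (2 * / (Cmod x * Cmod x * Cmod x))%R with (/ (Cmod x * Cmod x * (Cmod x / 2)))%R
  by (field; lra).
assert (Hx2 : (0 < Cmod x * Cmod x)%R) by nra.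
apply Rinv_le_contravar; [apply Rmult_lt_0_compat; lra|].
apply Rmult_le_compat_l; lra.
Qed.

Lemma cderiv_csum (f df : nat -> C -> C) (x : C) (n : nat) :
  (forall k, (k < n)%nat -> cderiv (f k) x (df k x)) ->
  cderiv (fun y => csum (fun k => f k y) n) x (csum (fun k => df k x) n).
Proof.
induction n as [|n IH]; intros H; simpl; [apply cderiv_const|].
apply (cderiv_plus (fun y => csum (fun k => f k y) n)); auto.
Qed.

(** * Mean value and Taylor inequalities; limits of differentiable functions *)

(** Restricts [f] to the line through [x] in direction [h] and composes it with [p], the real or
    imaginary part, so that the real mean value theorem becomes applicable. *)
Lemma cderiv_component (p : C -> R) (f df : C -> C) (x h : C) (t : R) :
  (forall x y : C, p (x - y) = (p x - p y)%R) ->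
  (forall x, Rabs (p x) <= Cmod x)%R ->
  (forall (s : R) x, p (RtoC s * x) = (s * p x)%R) ->
  cderiv f (x + RtoC t * h) (df (x + RtoC t * h)) ->
  derivable_pt_lim (fun s => p (f (x + RtoC s * h))) t (p (h * df (x + RtoC t * h))).
Proof.
intros Hsub Hle Hscal H eps Heps.
pose proof (Cmod_ge_0 h) as Hh.
set (e := (eps / 2 / (Cmod h + 1))%R).
assert (He : (0 < e)%R) by (apply Rdiv_lt_0_compat; lra).
destruct (H e He) as [d [Hd Hd']].
assert (Hd2 : (0 < d / (Cmod h + 1))%R) by (apply Rdiv_lt_0_compat; lra).
exists (mkposreal _ Hd2); simpl; intros s Hs0 Hs.
assert (Hs1 : (0 < Rabs s)%R) by now apply Rabs_pos_lt.
apply Rlt_div_r in Hs; [|lra].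
specialize (Hd' (x + RtoC (t + s) * h)).
replace (x + RtoC (t + s) * h - (x + RtoC t * h)) with (RtoC s * h) in Hd'
  by (rewrite RtoC_plus; ring).
rewrite Cmod_mult, Cmod_R in Hd'.
specialize (Hd' ltac:(nra)).
set (z1 := f (x + RtoC (t + s) * h)) in *; set (z0 := f (x + RtoC t * h)) in *.
set (z2 := df (x + RtoC t * h)) in *.
replace ((p z1 - p z0) / s - p (h * z2)%C)%R
  with (p (z1 - z0 - RtoC s * h * z2)%C / s)%R.
2:{ rewrite !Hsub, <- Cmult_assoc, Hscal; now field. }
unfold Rdiv; rewrite Rabs_mult, Rabs_inv.
apply Rlt_div_l; [auto|].
eapply Rle_lt_trans; [apply Hle|].
eapply Rle_lt_trans; [exact Hd'|].
replace (e * (Rabs s * Cmod h))%R with (e * Cmod h * Rabs s)%R by ring.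
apply Rmult_lt_compat_r; auto.
apply Rle_lt_trans with (e * (Cmod h + 1))%R; [nra|].
unfold e; field_simplify; lra.
Qed.

(** The mean value theorem fails for complex values, so it is applied to the real and imaginary
    parts separately along the segment; adding the two bounds costs the factor [2]. *)
Lemma cderiv_mean_value (f df : C -> C) (x y : C) (M : R) :
  (forall t, 0 <= t <= 1 ->
     cderiv f (x + RtoC t * (y - x))%C (df (x + RtoC t * (y - x))%C)
     /\ Cmod (df (x + RtoC t * (y - x))%C) <= M)%R ->
  (Cmod (f y - f x)%C <= 2 * M * Cmod (y - x)%C)%R.
Proof.
intros H.
assert (Hcomp : forall p : C -> R,
  (forall x y : C, p (x - y) = (p x - p y)%R) ->
  (forall x, Rabs (p x) <= Cmod x)%R ->
  (forall (s : R) x, p (RtoC s * x) = (s * p x)%R) ->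
  (Rabs (p (f y - f x)%C) <= M * Cmod (y - x))%R).
{ intros p Hsub Hle Hscal.
  destruct (MVT_cor2 (fun t => p (f (x + RtoC t * (y - x))))
    (fun t => p ((y - x) * df (x + RtoC t * (y - x)))) 0 1) as [c [Hc Hc01]]; [lra| |].
  - intros c Hc; apply (cderiv_component p f df); auto; now apply H.
  - replace (x + RtoC 1 * (y - x)) with y in Hc by ring.
    replace (x + RtoC 0 * (y - x)) with x in Hc by ring.
    rewrite Hsub, Hc, Rminus_0_r, Rmult_1_r.
    eapply Rle_trans; [apply Hle|]; rewrite Cmod_mult, Rmult_comm.
    apply Rmult_le_compat_r; [apply Cmod_ge_0|apply H; lra]. }
pose proof (Hcomp Re) as HRe; pose proof (Hcomp Im) as HIm.
assert (E1 : (Rabs (Re (f y - f x)) <= M * Cmod (y - x))%R).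
{ apply HRe; [intros [? ?] [? ?]; reflexivity|apply re_le_Cmod|].
  intros s [? ?]; simpl; ring. }
assert (E2 : (Rabs (Im (f y - f x)) <= M * Cmod (y - x))%R).
{ apply HIm; [intros [? ?] [? ?]; reflexivity|apply im_le_Cmod|].
  intros s [? ?]; simpl; ring. }
eapply Rle_trans; [apply Cmod_le_re_im|lra].
Qed.

Lemma segment_in_ball (x y : C) (t : R) :
  (0 <= t <= 1)%R -> (Cmod (x + RtoC t * (y - x) - x) <= Cmod (y - x))%R.
Proof.
intros Ht; replace (x + RtoC t * (y - x) - x) with (RtoC t * (y - x)) by ring.
rewrite Cmod_mult, Cmod_R, Rabs_pos_eq by lra.
pose proof (Cmod_ge_0 (y - x)); nra.
Qed.

(** The mean value inequality is used twice: for [f z - df x * z], whose derivative is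
    [df z - df x], and for [df], which bounds that derivative by [2 * M * Cmod (z - x)]. Hence
    [4 = 2 * 2]. *)
Lemma cderiv_taylor (f df ddf : C -> C) (x : C) (r M : R) :
  (forall y, (Cmod (y - x)%C < r)%R ->
     cderiv f y (df y) /\ cderiv df y (ddf y) /\ (Cmod (ddf y) <= M)%R) ->
  forall y, (Cmod (y - x)%C < r)%R ->
  (Cmod (f y - f x - (y - x) * df x)%C <= 4 * M * (Cmod (y - x)%C)²)%R.
Proof.
intros H y Hy.
assert (Hr : (0 < r)%R) by (pose proof (Cmod_ge_0 (y - x)); lra).
assert (HM : (0 <= M)%R).
{ destruct (H y Hy) as (_ & _ & HM); pose proof (Cmod_ge_0 (ddf y)); lra. }
replace (f y - f x - (y - x) * df x) with
  ((f y - df x * y) - (f x - df x * x)) by ring.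
replace (4 * M * (Cmod (y - x))²)%R with (2 * (2 * M * Cmod (y - x)) * Cmod (y - x))%R
  by (unfold Rsqr; ring).
apply (cderiv_mean_value (fun z => f z - df x * z) (fun z => df z - df x)).
intros t Ht.
pose proof (segment_in_ball x y t Ht) as Hz.
set (z := x + RtoC t * (y - x)) in *.
split.
- replace (df z - df x) with (df z + (- df x) * 1) by ring.
  apply (cderiv_ext (fun z => f z + (- df x) * z)); [intros; ring|].
  apply cderiv_plus; [apply H; lra|apply cderiv_scal, cderiv_id].
- apply Rle_trans with (2 * M * Cmod (z - x))%R; [|nra].
  apply (cderiv_mean_value df ddf).
  intros s Hs; pose proof (segment_in_ball x z s Hs).
  destruct (H (x + RtoC s * (z - x))) as (_ & H1 & H2); [lra|auto].
Qed.

(* A uniform bound on the second derivatives makes the difference quotients converge uniformly in [n]. *)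
Lemma cvg_cderiv (f df ddf : nat -> C -> C) (F : C -> C) (x l : C) (r M : R) :
  (0 < r)%R ->
  (forall n y, (Cmod (y - x)%C < r)%R ->
     cderiv (f n) y (df n y) /\ cderiv (df n) y (ddf n y) /\ (Cmod (ddf n y) <= M)%R) ->
  (forall y, (Cmod (y - x)%C < r)%R -> cvg (fun n => f n y) (F y)) ->
  cderiv F x l -> cvg (fun n => df n x) l.
Proof.
intros Hr H HF Hl; apply is_lim_seq_spec; intros eps.
pose proof (cond_pos eps) as Heps.
assert (Hx : (Cmod (x - x) < r)%R)
  by (replace (x - x) with (RtoC 0) by ring; now rewrite Cmod_0).
assert (HM : (0 <= M)%R).
{ destruct (H 0%nat x Hx) as (_ & _ & HM); pose proof (Cmod_ge_0 (ddf 0%nat x)); lra. }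
destruct (Hl (eps / 4)%R ltac:(lra)) as [d [Hd Hd']].
assert (HM1 : (0 < eps / (16 * (M + 1)))%R) by (apply Rdiv_lt_0_compat; lra).
(* The step must stay in both balls and keep the Taylor error [4 * M * h^2] below [eps / 4 * h].
   Using [M + 1] avoids a zero denominator, and the final halving makes the inequalities strict. *)
set (h := (Rmin (Rmin r d) (eps / (16 * (M + 1))) / 2)%R).
assert (Hmin : (0 < Rmin (Rmin r d) (eps / (16 * (M + 1))))%R)
  by (repeat apply Rmin_pos; auto).
assert (Hh : (0 < h)%R) by (unfold h; lra).
assert (Hhr : (h < r)%R).
{ unfold h; pose proof (Rmin_l (Rmin r d) (eps / (16 * (M + 1)))).
  pose proof (Rmin_l r d); lra. }
assert (Hhd : (h < d)%R).
{ unfold h; pose proof (Rmin_l (Rmin r d) (eps / (16 * (M + 1)))).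
  pose proof (Rmin_r r d); lra. }
assert (HhM : (h <= eps / (16 * (M + 1)))%R).
{ unfold h; pose proof (Rmin_r (Rmin r d) (eps / (16 * (M + 1)))); lra. }
set (y := x + RtoC h).
assert (Hyx : y - x = RtoC h) by (unfold y; ring).
assert (Hmod : Cmod (y - x) = h) by (rewrite Hyx, Cmod_R; apply Rabs_pos_eq; lra).
pose proof (cvg_minus _ _ _ _ (HF y ltac:(lra)) (HF x Hx)) as Hdiff.
apply is_lim_seq_spec in Hdiff.
assert (Heh : (0 < eps / 4 * h)%R) by nra.
destruct (Hdiff (mkposreal _ Heh)) as [N HN]; exists N; intros n Hn.
specialize (HN n Hn); simpl in HN.
rewrite Rminus_0_r, Rabs_pos_eq in HN |- * by apply Cmod_ge_0.
pose proof (cderiv_taylor (f n) (df n) (ddf n) x r M (fun y Hy => H n y Hy) y ltac:(lra)) as HT.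
specialize (Hd' y ltac:(lra)).
rewrite Hmod, Hyx in HT, Hd'.
apply (Rmult_lt_reg_r h); auto.
replace (Cmod (df n x - l) * h)%R with (Cmod (RtoC h * (df n x - l)))
  by (rewrite Cmod_mult, Cmod_R, Rabs_pos_eq by lra; ring).
replace (RtoC h * (df n x - l)) with
  ((F y - F x - RtoC h * l) + ((f n y - f n x - (F y - F x)) -
    (f n y - f n x - RtoC h * df n x))) by ring.
eapply Rle_lt_trans; [apply Cmod_triangle|].
assert (HT3 : (Cmod (f n y - f n x - (F y - F x) - (f n y - f n x - RtoC h * df n x))
  <= Cmod (f n y - f n x - (F y - F x)) + Cmod (f n y - f n x - RtoC h * df n x))%R).
{ unfold Cminus at 1; eapply Rle_trans; [apply Cmod_triangle|]; rewrite Cmod_opp; lra. }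
assert (HT4 : (4 * M * h² <= eps / 4 * h)%R).
{ unfold Rsqr; replace (4 * M * (h * h))%R with (4 * M * h * h)%R by ring.
  apply Rmult_le_compat_r; [lra|].
  apply Rle_trans with (4 * (M + 1) * (eps / (16 * (M + 1))))%R.
  - apply Rmult_le_compat; lra.
  - right; field; lra. }
lra.
Qed.

(** Differentiability of the limit is a conclusion here: the constants of the Taylor inequality do
    not depend on [n], so it survives the passage to the limit and gives [F] a quadratic
    remainder. *)
Lemma cderiv_of_cvg (f df ddf : nat -> C -> C) (F : C -> C) (x l : C) (r M : R) :
  (0 < r)%R ->
  (forall n y, (Cmod (y - x)%C < r)%R ->
     cderiv (f n) y (df n y) /\ cderiv (df n) y (ddf n y) /\ (Cmod (ddf n y) <= M)%R) ->
  (forall y, (Cmod (y - x)%C < r)%R -> cvg (fun n => f n y) (F y)) ->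
  cvg (fun n => df n x) l -> cderiv F x l.
Proof.
intros Hr H HF Hl; apply (cderiv_quadratic _ _ _ r (4 * M)); auto.
intros y Hy.
assert (Hx : (Cmod (x - x) < r)%R)
  by (replace (x - x) with (RtoC 0) by ring; now rewrite Cmod_0).
apply (cvg_Cmod_le (fun n => f n y - f n x - (y - x) * df n x)).
- apply cvg_minus; [apply cvg_minus; auto|now apply cvg_scal].
- intros n; apply (cderiv_taylor (f n) (df n) (ddf n) x r M); auto.
Qed.

(** * The complex exponential *)

Lemma Cexp_plus (z w : C) : Cexp (z + w) = Cexp z * Cexp w.
Proof.
destruct z as [x y], w as [x' y']; unfold Cexp, Cplus, Cmult; simpl.
rewrite exp_plus, cos_plus, sin_plus; f_equal; ring.
Qed.

Lemma Cexp_RtoC (x : R) : Cexp (RtoC x) = RtoC (exp x).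
Proof. unfold Cexp, RtoC; simpl; rewrite cos_0, sin_0; f_equal; ring. Qed.

Lemma Cexp_0 : Cexp 0 = 1.
Proof. now rewrite Cexp_RtoC, exp_0. Qed.

Lemma Cmod_Cexp (z : C) : Cmod (Cexp z) = exp (Re z).
Proof.
unfold Cmod, Cexp; simpl fst; simpl snd.
replace ((exp (Re z) * cos (Im z)) ^ 2 + (exp (Re z) * sin (Im z)) ^ 2)%R
  with ((exp (Re z))² * ((sin (Im z))² + (cos (Im z))²))%R by (unfold Rsqr; ring).
rewrite sin2_cos2, Rmult_1_r; apply sqrt_Rsqr, Rlt_le, exp_pos.
Qed.

Lemma Cexp_neq_0 (z : C) : Cexp z <> 0.
Proof. apply Cmod_gt_0; rewrite Cmod_Cexp; apply exp_pos. Qed.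

Lemma Cexp_opp (z : C) : Cexp (- z) = / Cexp z.
Proof.
pose proof (Cexp_neq_0 z) as Hz.
replace (Cexp (- z)) with (Cexp (- z) * Cexp z * / Cexp z) by (now field).
rewrite <- Cexp_plus; replace (- z + z) with (RtoC 0) by ring.
rewrite Cexp_0; ring.
Qed.

Lemma sin_le_abs (y : R) : (Rabs (sin y) <= Rabs y)%R.
Proof.
destruct (MVT_abs sin cos 0 y) as [c [Hc _]].
- intros c _; apply derivable_pt_lim_sin.
- rewrite sin_0, !Rminus_0_r in Hc; rewrite Hc.
  assert (Rabs (cos c) <= 1)%R by (apply Rabs_le; pose proof (COS_bound c); lra).
  pose proof (Rabs_pos y); nra.
Qed.

Lemma cos_quadratic (y : R) : (Rabs (cos y - 1) <= y² / 2)%R.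
Proof.
replace (cos y - 1)%R with (- (2 * (sin (y / 2))²))%R.
- assert (H : ((sin (y / 2))² <= (y / 2)²)%R) by (apply Rsqr_le_abs_1, sin_le_abs).
  rewrite Rabs_Ropp, Rabs_pos_eq; unfold Rsqr in *; nra.
- replace y with (2 * (y / 2))%R at 2 by field; rewrite cos_2a_sin; unfold Rsqr; ring.
Qed.

Lemma sin_quadratic (y : R) : (Rabs y <= 1 -> Rabs (sin y - y) <= y²)%R.
Proof.
intros Hy.
destruct (MVT_abs (fun y => sin y - y)%R (fun y => cos y - 1)%R 0 y) as [c [Hc [H1 H2]]].
- intros c _; apply derivable_pt_lim_minus; [apply derivable_pt_lim_sin|apply derivable_pt_lim_id].
- rewrite sin_0, !Rminus_0_r in Hc; rewrite Hc.
  assert (Hcy : (Rabs c <= Rabs y)%R).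
  { revert H1 H2; unfold Rmin, Rmax; destruct (Rle_dec 0 y); intros;
    unfold Rabs; destruct (Rcase_abs c), (Rcase_abs y); lra. }
  pose proof (cos_quadratic c) as Hq.
  rewrite (Rsqr_abs c) in Hq; rewrite (Rsqr_abs y).
  pose proof (Rabs_pos c); pose proof (Rabs_pos y); unfold Rsqr in *.
  apply Rmult_le_compat_r; nra.
Qed.

Lemma exp_quadratic (x : R) : (Rabs x <= 1 / 2 -> Rabs (exp x - 1 - x) <= 2 * x²)%R.
Proof.
intros Hx; apply Rabs_le_between in Hx.
pose proof (exp_ineq1_le x) as H1; pose proof (exp_ineq1_le (- x)) as H2.
pose proof (exp_pos x) as H3.
assert (H4 : (exp x * exp (- x) = 1)%R) by (rewrite <- exp_plus, Rplus_opp_r; apply exp_0).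
rewrite Rabs_pos_eq by lra.
assert (H5 : (exp x * (1 - x) <= 1)%R) by nra.
unfold Rsqr; nra.
Qed.

(** Second-order bounds for the real [exp], [cos] and [sin] are combined in each component. The
    constant is not sharp: the estimate only serves to find the derivative of [Cexp]. *)
Lemma Cexp_quadratic_0 (w : C) :
  (Cmod w < 1 / 2 -> Cmod (Cexp w - 1 - w)%C <= 6 * (Cmod w)²)%R.
Proof.
intros Hw.
pose proof (re_le_Cmod w) as Hx; pose proof (im_le_Cmod w) as Hy.
assert (HS : ((Re w)² + (Im w)² = (Cmod w)²)%R).
{ pose proof (Cmod2_alt w); unfold Rsqr; simpl in *; lra. }
eapply Rle_trans; [apply Cmod_le_re_im|].
set (x := Re w) in *; set (y := Im w) in *.
replace (Re (Cexp w - 1 - w)) with (exp x * cos y - 1 - x)%R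
  by (unfold x, y; destruct w; simpl; ring).
replace (Im (Cexp w - 1 - w)) with (exp x * sin y - y)%R
  by (unfold x, y; destruct w; simpl; ring).
pose proof (exp_quadratic x ltac:(lra)) as E1.
pose proof (cos_quadratic y) as E2.
pose proof (sin_quadratic y ltac:(lra)) as E3.
pose proof (exp_pos x) as Ep.
assert (Ex : (exp x <= 2)%R).
{ apply Rabs_le_between in E1; assert (Hx2 : (Rabs x <= 1 / 2)%R) by lra.
  apply Rabs_le_between in Hx2; unfold Rsqr in *; nra. }
assert (Ey : (Rabs (exp x - 1) <= 2 * Rabs x)%R).
{ replace (exp x - 1)%R with ((exp x - 1 - x) + x)%R by ring.
  eapply Rle_trans; [apply Rabs_triang|].
  rewrite (Rsqr_abs x) in E1; pose proof (Rabs_pos x); unfold Rsqr in *; nra. }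
replace (exp x * cos y - 1 - x)%R with ((exp x - 1 - x) + exp x * (cos y - 1))%R by ring.
replace (exp x * sin y - y)%R with ((exp x - 1) * y + exp x * (sin y - y))%R by ring.
pose proof (Rabs_triang (exp x - 1 - x) (exp x * (cos y - 1))) as T1.
pose proof (Rabs_triang ((exp x - 1) * y) (exp x * (sin y - y))) as T2.
rewrite Rabs_mult, (Rabs_pos_eq (exp x)) in T1 by lra.
rewrite (Rabs_mult (exp x - 1) y), (Rabs_mult (exp x)), (Rabs_pos_eq (exp x)) in T2 by lra.
assert (B1 : (exp x * Rabs (cos y - 1) <= 2 * (y² / 2))%R)
  by (apply Rmult_le_compat; try lra; apply Rabs_pos).
assert (B2 : (exp x * Rabs (sin y - y) <= 2 * y²)%R)
  by (apply Rmult_le_compat; try lra; apply Rabs_pos).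
assert (B3 : (Rabs (exp x - 1) * Rabs y <= x² + y²)%R).
{ rewrite (Rsqr_abs x), (Rsqr_abs y); unfold Rsqr.
  pose proof (Rabs_pos x); pose proof (Rabs_pos y).
  apply Rle_trans with (2 * Rabs x * Rabs y)%R; [nra|].
  pose proof (Rle_0_sqr (Rabs x - Rabs y)); unfold Rsqr in *; nra. }
pose proof (Rle_0_sqr x); pose proof (Rle_0_sqr y); lra.
Qed.

Lemma cderiv_Cexp (x : C) : cderiv Cexp x (Cexp x).
Proof.
apply (cderiv_quadratic _ _ _ (1 / 2) (6 * Cmod (Cexp x))); [lra|].
intros y Hy.
replace (Cexp y) with (Cexp x * Cexp (y - x)) by (rewrite <- Cexp_plus; f_equal; ring).
replace (Cexp x * Cexp (y - x) - Cexp x - (y - x) * Cexp x) with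
  (Cexp x * (Cexp (y - x) - 1 - (y - x))) by ring.
rewrite Cmod_mult; pose proof (Cexp_quadratic_0 _ Hy); pose proof (Cmod_ge_0 (Cexp x)).
unfold Rsqr in *; nra.
Qed.

Lemma cderiv_Cexp_scal (c x : C) :
  cderiv (fun z => Cexp (c * z)) x (c * Cexp (c * x)).
Proof.
replace (c * Cexp (c * x)) with (c * 1 * Cexp (c * x)) by ring.
apply (cderiv_comp (fun z => c * z)).
- apply cderiv_scal, cderiv_id.
- apply cderiv_Cexp.
Qed.

(** Once [Cexp] is known to be its own derivative, the Taylor inequality at [0] reaches any radius,
    the second derivative being at most [exp R0]. *)
Lemma Cexp_quadratic (R0 : R) (w : C) :
  (Cmod w < R0 -> Cmod (Cexp w - 1 - w)%C <= 4 * exp R0 * (Cmod w)²)%R.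
Proof.
intros Hw; assert (Hw' : (Cmod (w - 0) < R0)%R) by (now replace (w - 0) with w by ring).
pose proof (cderiv_taylor Cexp Cexp Cexp 0 R0 (exp R0)) as HT.
assert (Hb : forall y, (Cmod (y - 0) < R0)%R ->
  cderiv Cexp y (Cexp y) /\ cderiv Cexp y (Cexp y) /\ (Cmod (Cexp y) <= exp R0)%R).
{ intros y Hy; split; [|split]; try apply cderiv_Cexp.
  replace (y - 0) with y in Hy by ring.
  rewrite Cmod_Cexp; apply Rlt_le, exp_increasing.
  pose proof (re_le_Cmod y); pose proof (Rle_abs (Re y)); lra. }
specialize (HT Hb w Hw'); rewrite Cexp_0 in HT.
replace (w - 0) with w in HT by ring.
now replace (Cexp w - 1 - w * 1) with (Cexp w - 1 - w) in HT by ring.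
Qed.

(** * Pochhammer symbols and their logarithmic derivatives *)

(** The logarithmic derivative of [pochhammer z n]; [S2] below is minus the derivative of [S1]. *)
Definition S1 (z : C) (n : nat) : C := csum (fun k => / (z + RtoC (INR k))) n.
Definition S2 (z : C) (n : nat) : C :=
  csum (fun k => / ((z + RtoC (INR k)) * (z + RtoC (INR k)))) n.

Lemma cderiv_shift (c x : C) : cderiv (fun z => z + c) x 1.
Proof.
replace (RtoC 1) with (1 + 0) by ring.
apply (cderiv_plus (fun z => z)); [apply cderiv_id|apply cderiv_const].
Qed.

Lemma cderiv_S1 (z : C) (n : nat) :
  (forall k, (k < n)%nat -> z + RtoC (INR k) <> 0) ->
  cderiv (fun y => S1 y n) z (- S2 z n).
Proof.
intros H; replace (- S2 z n) with
  (csum (fun k => - / ((z + RtoC (INR k)) * (z + RtoC (INR k)))) n).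
- unfold S1.
  apply (cderiv_csum (fun k y => / (y + RtoC (INR k)))
    (fun k y => - / ((y + RtoC (INR k)) * (y + RtoC (INR k))))).
  intros k Hk.
  replace (- / ((z + RtoC (INR k)) * (z + RtoC (INR k)))) with
   (1 * (- / ((z + RtoC (INR k)) * (z + RtoC (INR k))))) by ring.
  apply (cderiv_comp (fun y => y + RtoC (INR k)) Cinv); [apply cderiv_shift|].
  apply cderiv_inv; auto.
- unfold S2; set (f := fun k => / ((z + RtoC (INR k)) * (z + RtoC (INR k)))).
  replace (- csum f n) with ((- (1)) * csum f n) by ring.
  rewrite <- csum_scal; apply csum_ext; intros; unfold f; ring.
Qed.

Lemma cderiv_pochhammer (z : C) (n : nat) :
  (forall k, (k < n)%nat -> z + RtoC (INR k) <> 0) ->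
  cderiv (fun y => pochhammer y n) z (pochhammer z n * S1 z n).
Proof.
induction n as [|n IH]; intros H; simpl.
- unfold S1; simpl; rewrite Cmult_0_r; apply cderiv_const.
- replace (pochhammer z n * (z + RtoC (INR n)) * S1 z (S n)) with
    (pochhammer z n * S1 z n * (z + RtoC (INR n)) + pochhammer z n * 1).
  + apply (cderiv_mult (fun y => pochhammer y n) (fun y => y + RtoC (INR n))); [apply IH; auto|apply cderiv_shift].
  + unfold S1; simpl; field; auto.
Qed.

(** When [s] is the logarithmic derivative of [f], this writes the second derivative as a multiple
    of [f], the form in which it is bounded for Euler's sequence and for the binomial
    coefficients. *)
Lemma cderiv_log_second (f s : C -> C) (z t : C) :
  cderiv f z (f z * s z) -> cderiv s z t ->
  cderiv (fun y => f y * s y) z (f z * (s z * s z + t)).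
Proof.
intros Hf Hs.
replace (f z * (s z * s z + t)) with (f z * s z * s z + f z * t) by ring.
now apply cderiv_mult.
Qed.

Lemma pochhammer_neq_0 (z : C) (n : nat) :
  (forall k, (k < n)%nat -> z + RtoC (INR k) <> 0) -> pochhammer z n <> 0.
Proof.
induction n as [|n IH]; intros H; simpl; [apply C1_nz|].
apply Cmult_neq_0; auto.
Qed.

Lemma pochhammer_succ_l (z : C) (n : nat) :
  pochhammer z (S n) = z * pochhammer (z + 1) n.
Proof.
induction n as [|n IH]; [simpl; ring|].
change (pochhammer z (S (S n))) with (pochhammer z (S n) * (z + RtoC (INR (S n)))).
rewrite IH, RtoC_INR_S; simpl; ring.
Qed.

Lemma Re_le_Cmod_shift (z : C) (k : nat) :
  (Re z + INR k <= Cmod (z + RtoC (INR k)))%R.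
Proof.
pose proof (re_le_Cmod (z + RtoC (INR k))) as H.
pose proof (Rle_abs (Re (z + RtoC (INR k)))) as H'.
replace (Re (z + RtoC (INR k))) with (Re z + INR k)%R in * by (destruct z; reflexivity).
lra.
Qed.

Lemma Re_pos_shift_neq_0 (z : C) (k : nat) :
  (0 < Re z)%R -> z + RtoC (INR k) <> 0.
Proof.
intros H; apply Cmod_gt_0; pose proof (Re_le_Cmod_shift z k); pose proof (pos_INR k); lra.
Qed.

(** * The Gamma function *)

(** Each factor has modulus at most [1 + v n <= exp (v n)]. *)
Lemma product_bound (p h : nat -> C) (v : nat -> R) :
  (forall n, p (S n) = p n * h n) -> (forall n, Cmod (h n - 1)%C <= v n)%R ->
  forall n, (Cmod (p n) <= Cmod (p 0%nat) * exp (rsum v n))%R.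
Proof.
intros Hp Hh; induction n as [|n IH]; simpl.
- rewrite exp_0; lra.
- rewrite Hp, Cmod_mult, exp_plus, <- Rmult_assoc.
  apply Rmult_le_compat; auto using Cmod_ge_0.
  eapply Rle_trans; [apply (Cmod_le_trans _ 1)|]; rewrite Cmod_1.
  eapply Rle_trans; [|apply exp_ineq1_le]; specialize (Hh n); lra.
Qed.

(** Since the partial products stay bounded, summability of [h n - 1] gives summability of the
    increments of [p]. *)
Lemma product_cvg (p h : nat -> C) (v : nat -> R) (B : R) :
  (forall n, p (S n) = p n * h n) -> (forall n, Cmod (h n - 1)%C <= v n)%R ->
  (forall n, rsum v n <= B)%R -> exists l, cvg p l.
Proof.
intros Hp Hh HB.
set (A := (Cmod (p 0%nat) * exp B)%R).
assert (HA : forall n, (Cmod (p n) <= A)%R).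
{ intros n; eapply Rle_trans; [apply (product_bound p h v Hp Hh)|].
  apply Rmult_le_compat_l; [apply Cmod_ge_0|].
  destruct (HB n); [now apply Rlt_le, exp_increasing|right; congruence]. }
assert (HA0 : (0 <= A)%R) by (eapply Rle_trans; [apply Cmod_ge_0|apply (HA 0%nat)]).
apply (cvg_of_abs_summable p (fun n => A * v n)%R (A * B)%R).
- intros n; rewrite Hp; replace (p n * h n - p n) with (p n * (h n - 1)) by ring.
  rewrite Cmod_mult; apply Rmult_le_compat; auto using Cmod_ge_0.
- intros n; rewrite rsum_scal; now apply Rmult_le_compat_l.
Qed.

(** * Euler's sequence as an infinite product in the right half-plane *)

Definition euler_gamma_seq (n : nat) (z : C) : C :=
  RtoC (INR (fact n)) * RCpower (INR n) z / pochhammer z (S n).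

Definition dlog_gamma_seq (n : nat) (z : C) : C := RtoC (ln (INR n)) - S1 z (S n).

(** Equal to [1 / ((n + 1) (n + 2))]: a telescoping majorant to which every error of order [1 / n^2]
    in this section is reduced. *)
Definition tele (n : nat) : R := (/ (INR n + 1) - / (INR n + 2))%R.

Lemma rsum_tele_le (n : nat) : (rsum tele n <= 1)%R.
Proof.
assert (H : rsum tele n = (1 - / (INR n + 1))%R).
{ induction n as [|n IH]; [simpl; field|].
  simpl rsum; rewrite IH; unfold tele; rewrite S_INR.
  pose proof (pos_INR n); field; lra. }
rewrite H; pose proof (pos_INR n).
assert (0 < / (INR n + 1))%R by (apply Rinv_0_lt_compat; lra); lra.
Qed.

Lemma inv_sqr_le_tele (n : nat) : (/ (INR n + 1)² <= 2 * tele n)%R.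
Proof.
pose proof (pos_INR n) as H; unfold tele, Rsqr.
apply Rminus_le_0.
replace (2 * (/ (INR n + 1) - / (INR n + 2)) - / ((INR n + 1) * (INR n + 1)))%R
  with (INR n / ((INR n + 1) * (INR n + 1) * (INR n + 2)))%R by (field; lra).
apply Rdiv_le_0_compat; [lra|]; repeat apply Rmult_lt_0_compat; lra.
Qed.

(** The inequality [ln x <= x - 1] at the quotient [(n + 2) / (n + 1)] and at its reciprocal. *)
Lemma ln_step_bounds (n : nat) :
  (/ (INR n + 2) <= ln (INR n + 2) - ln (INR n + 1) <= / (INR n + 1))%R.
Proof.
pose proof (pos_INR n) as H.
assert (Hexp : forall x, (0 < x)%R -> (ln x <= x - 1)%R).
{ intros x Hx; pose proof (exp_ineq1_le (ln x)); rewrite exp_ln in *; lra. }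
assert (H1 := Hexp ((INR n + 2) / (INR n + 1))%R ltac:(apply Rdiv_lt_0_compat; lra)).
assert (H2 := Hexp ((INR n + 1) / (INR n + 2))%R ltac:(apply Rdiv_lt_0_compat; lra)).
rewrite ln_div in H1, H2 by lra.
replace ((INR n + 2) / (INR n + 1) - 1)%R with (/ (INR n + 1))%R in H1 by (field; lra).
replace ((INR n + 1) / (INR n + 2) - 1)%R with (- / (INR n + 2))%R in H2 by (field; lra).
lra.
Qed.

(** The ratio of consecutive terms of Euler's sequence, from index [n + 1] to [n + 2]; the shift
    keeps the logarithms away from [ln 0]. *)
Definition gamma_step (n : nat) (z : C) : C :=
  Cexp (z * RtoC (ln (INR n + 2) - ln (INR n + 1)))
  * (RtoC (INR n + 2) / (z + RtoC (INR n + 2))).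

Lemma euler_gamma_seq_step (n : nat) (z : C) :
  (forall k, z + RtoC (INR k) <> 0) ->
  euler_gamma_seq (S (S n)) z = euler_gamma_seq (S n) z * gamma_step n z.
Proof.
intros Hz; unfold euler_gamma_seq, gamma_step, RCpower.
change (fact (S (S n))) with (S (S n) * fact (S n))%nat.
change (pochhammer z (S (S (S n)))) with (pochhammer z (S (S n)) * (z + RtoC (INR (S (S n))))).
rewrite mult_INR.
assert (E2 : INR (S (S n)) = (INR n + 2)%R) by (rewrite !S_INR; ring).
assert (E1 : INR (S n) = (INR n + 1)%R) by (rewrite !S_INR; ring).
assert (Hz2 : z + RtoC (INR n + 2) <> 0) by (rewrite <- E2; apply Hz).
assert (Hp := pochhammer_neq_0 z (S (S n)) (fun k _ => Hz k)).
rewrite E2, E1, RtoC_mult.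
replace (z * RtoC (ln (INR n + 2))) with
  (z * RtoC (ln (INR n + 1)) + z * RtoC (ln (INR n + 2) - ln (INR n + 1)))
  by (rewrite RtoC_minus; ring).
rewrite Cexp_plus; field; split; auto.
Qed.

(** The first summand comes from the exponential remainder [4 * exp R0 * (R0 / (n + 1))^2] together
    with [1 / (n + 1)^2 <= 2 * tele n], the second from replacing [ln ((n + 2) / (n + 1))] by
    [1 / (n + 2)]. *)
Definition gamma_const (R0 : R) : R := (8 * exp R0 * (R0 * R0) + R0)%R.

Lemma gamma_exp_bound (R0 : R) (n : nat) (z : C) :
  (0 <= Re z)%R -> (Cmod z < R0)%R ->
  (Cmod (Cexp (z * RtoC (ln (INR n + 2) - ln (INR n + 1))) - 1
        - z / RtoC (INR n + 2))%C <= gamma_const R0 * tele n)%R.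
Proof.
intros Hre HR; pose proof (pos_INR n) as Hn; pose proof (Cmod_ge_0 z) as Hz0.
destruct (ln_step_bounds n) as [L1 L2].
set (l := (ln (INR n + 2) - ln (INR n + 1))%R) in *.
assert (Hi : (0 < / (INR n + 2))%R) by (apply Rinv_0_lt_compat; lra).
assert (Hi1 : (/ (INR n + 1) <= 1)%R).
{ apply Rle_trans with (/ 1)%R; [apply Rinv_le_contravar; lra|rewrite Rinv_1; lra]. }
assert (Hn2 : RtoC (INR n + 2) <> 0) by (intros E; apply RtoC_inj in E; lra).
replace (Cexp (z * RtoC l) - 1 - z / RtoC (INR n + 2)) with
  ((Cexp (z * RtoC l) - 1 - z * RtoC l) + z * (RtoC l - / RtoC (INR n + 2)))
  by (field; auto).
eapply Rle_trans; [apply Cmod_triangle|].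
assert (Hzl : Cmod (z * RtoC l) = (Cmod z * l)%R)
  by (rewrite Cmod_mult, Cmod_R, Rabs_pos_eq; lra).
assert (E1 : (Cmod (Cexp (z * RtoC l) - 1 - z * RtoC l) <= 4 * exp R0 * (Cmod z * l)²)%R).
{ rewrite <- Hzl; apply Cexp_quadratic; rewrite Hzl; nra. }
assert (E2 : (Cmod (z * (RtoC l - / RtoC (INR n + 2))) <= R0 * tele n)%R).
{ rewrite <- RtoC_inv, <- RtoC_minus, Cmod_mult, Cmod_R, Rabs_pos_eq by lra.
  unfold tele; apply Rmult_le_compat; lra. }
assert (E3 : ((Cmod z * l)² <= R0 * R0 * (2 * tele n))%R).
{ rewrite Rsqr_mult; apply Rmult_le_compat; try apply Rle_0_sqr.
  - unfold Rsqr; nra.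
  - eapply Rle_trans; [|apply inv_sqr_le_tele].
    rewrite <- Rsqr_inv'; unfold Rsqr; nra. }
pose proof (exp_pos R0); unfold gamma_const; nra.
Qed.

Lemma Cmod_shift_ge (z : C) (x : R) :
  (0 <= Re z)%R -> (0 <= x)%R -> (x <= Cmod (z + RtoC x))%R.
Proof.
intros Hz Hx; eapply Rle_trans; [|apply re_le_Cmod].
destruct z as [a b]; simpl in *; rewrite Rabs_pos_eq; lra.
Qed.

(** [gamma_step n z - 1] is the quantity of [gamma_exp_bound] times [(n + 2) / (z + n + 2)], a
    factor of modulus at most [1] when [0 <= Re z]. *)
Lemma gamma_step_bound (R0 : R) (n : nat) (z : C) :
  (0 <= Re z)%R -> (Cmod z < R0)%R ->
  (Cmod (gamma_step n z - 1)%C <= gamma_const R0 * tele n)%R.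
Proof.
intros Hre HR; pose proof (pos_INR n) as Hn.
eapply Rle_trans; [|apply gamma_exp_bound; eauto].
pose proof (Cmod_shift_ge z (INR n + 2) Hre ltac:(lra)) as Hge.
assert (Hn2 : RtoC (INR n + 2) <> 0) by (intros E; apply RtoC_inj in E; lra).
assert (Hz : z + RtoC (INR n + 2) <> 0) by (apply Cmod_gt_0; lra).
unfold gamma_step; set (e := Cexp _).
replace (e * (RtoC (INR n + 2) / (z + RtoC (INR n + 2))) - 1) with
  ((e - 1 - z / RtoC (INR n + 2)) * (RtoC (INR n + 2) / (z + RtoC (INR n + 2))))
  by (field; auto).
rewrite Cmod_mult, Cmod_div, Cmod_R, Rabs_pos_eq by (auto; lra).
rewrite <- (Rmult_1_r (Cmod (e - 1 - z / RtoC (INR n + 2)))) at 2.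
apply Rmult_le_compat_l; [apply Cmod_ge_0|].
apply Rle_div_l; lra.
Qed.

(** Up to sign this is the quantity of [gamma_exp_bound] divided by an exponential of modulus at
    least [1]. Controlling the reciprocals is what rules out a zero limit. *)
Lemma gamma_step_inv_bound (R0 : R) (n : nat) (z : C) :
  (0 <= Re z)%R -> (Cmod z < R0)%R ->
  (Cmod (/ gamma_step n z - 1)%C <= gamma_const R0 * tele n)%R.
Proof.
intros Hre HR; pose proof (pos_INR n) as Hn.
eapply Rle_trans; [|apply gamma_exp_bound; eauto].
pose proof (Cmod_shift_ge z (INR n + 2) Hre ltac:(lra)) as Hge.
assert (Hn2 : RtoC (INR n + 2) <> 0) by (intros E; apply RtoC_inj in E; lra).
assert (Hz : z + RtoC (INR n + 2) <> 0) by (apply Cmod_gt_0; lra).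
destruct (ln_step_bounds n) as [L1 L2].
assert (Hi : (0 < / (INR n + 2))%R) by (apply Rinv_0_lt_compat; lra).
assert (He : (1 <= Cmod (Cexp (z * RtoC (ln (INR n + 2) - ln (INR n + 1)))))%R).
{ rewrite Cmod_Cexp.
  set (l := (ln (INR n + 2) - ln (INR n + 1))%R) in *.
  replace (Re (z * RtoC l)) with (Re z * l)%R by (destruct z; simpl; ring).
  eapply Rle_trans; [|apply exp_ineq1_le]; nra. }
unfold gamma_step; set (e := Cexp _) in *.
assert (He0 : e <> 0) by apply Cexp_neq_0.
replace (/ (e * (RtoC (INR n + 2) / (z + RtoC (INR n + 2)))) - 1) with
  (- ((e - 1 - z / RtoC (INR n + 2)) / e)) by (field; auto).
rewrite Cmod_opp, Cmod_div by auto.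
apply Rle_div_l; [lra|].
pose proof (Cmod_ge_0 (e - 1 - z / RtoC (INR n + 2))); nra.
Qed.

Lemma gamma_const_ge_0 (R0 : R) : (0 <= R0)%R -> (0 <= gamma_const R0)%R.
Proof. intros H; pose proof (exp_pos R0); unfold gamma_const; nra. Qed.

Lemma rsum_gamma_const (R0 : R) (n : nat) :
  (0 <= R0)%R -> (rsum (fun n => gamma_const R0 * tele n) n <= gamma_const R0)%R.
Proof.
intros H; rewrite rsum_scal.
pose proof (rsum_tele_le n); pose proof (gamma_const_ge_0 R0 H); nra.
Qed.

Lemma euler_gamma_seq_neq_0 (n : nat) (z : C) :
  (forall k, z + RtoC (INR k) <> 0) -> euler_gamma_seq n z <> 0.
Proof.
intros Hz; unfold euler_gamma_seq, Cdiv, RCpower.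
apply Cmult_neq_0; [apply Cmult_neq_0|].
- intros E; apply RtoC_inj in E; now apply (INR_fact_neq_0 n).
- apply Cexp_neq_0.
- intros E.
  pose proof (pochhammer_neq_0 z (S n) (fun k _ => Hz k)) as Hp.
  apply C1_nz; rewrite <- (Cinv_r _ Hp), E; ring.
Qed.

(** Euler's sequence and its reciprocal both converge as infinite products, and the product of their
    limits is [1]. *)
Lemma euler_gamma_seq_cvg (z : C) :
  (0 < Re z)%R ->
  cvg (fun n => euler_gamma_seq n z) (CGamma z) /\ CGamma z <> 0.
Proof.
intros Hz; assert (Hk := fun k => Re_pos_shift_neq_0 z k Hz).
set (R0 := (Cmod z + 1)%R).
assert (HR : (Cmod z < R0)%R) by (unfold R0; lra).
assert (HR0 : (0 <= R0)%R) by (unfold R0; pose proof (Cmod_ge_0 z); lra).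
destruct (product_cvg (fun n => euler_gamma_seq (S n) z) (fun n => gamma_step n z)
  (fun n => gamma_const R0 * tele n)%R (gamma_const R0)) as [l Hl].
- intros n; now apply euler_gamma_seq_step.
- intros n; apply gamma_step_bound; auto; lra.
- intros n; now apply rsum_gamma_const.
- destruct (product_cvg (fun n => / euler_gamma_seq (S n) z) (fun n => / gamma_step n z)
    (fun n => gamma_const R0 * tele n)%R (gamma_const R0)) as [m Hm].
  + intros n; rewrite euler_gamma_seq_step by auto.
    assert (H1 := euler_gamma_seq_neq_0 (S n) z Hk).
    assert (H2 := euler_gamma_seq_neq_0 (S (S n)) z Hk).
    rewrite euler_gamma_seq_step in H2 by auto.
    field; split; auto; intros E; apply H2; rewrite E; ring.
  + intros n; apply gamma_step_inv_bound; auto; lra.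
  + intros n; now apply rsum_gamma_const.
  + pose proof (cvg_incr_1 (fun n => euler_gamma_seq n z) l Hl) as Hl'.
    assert (E : CGamma z = l) by (apply cvg_CLim_seq; exact Hl').
    rewrite E; split; auto; intros E0.
    pose proof (cvg_mult _ _ _ _ Hl Hm) as H1.
    assert (H2 : l * m = 1).
    { apply (cvg_unique _ _ _ H1), (cvg_ext (fun _ => RtoC 1)); [|apply cvg_const].
      intros n; symmetry; apply Cinv_r, euler_gamma_seq_neq_0; auto. }
    apply C1_nz; rewrite <- H2, E0; ring.
Qed.

(** * Differentiability of Gamma in a right half-plane *)

Lemma cderiv_euler_gamma_seq (n : nat) (z : C) :
  (forall k, z + RtoC (INR k) <> 0) ->
  cderiv (euler_gamma_seq n) z (euler_gamma_seq n z * dlog_gamma_seq n z).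
Proof.
intros Hz.
assert (Hp := pochhammer_neq_0 z (S n) (fun k _ => Hz k)).
assert (HP := cderiv_pochhammer z (S n) (fun k _ => Hz k)).
unfold euler_gamma_seq, dlog_gamma_seq, RCpower.
set (c := RtoC (INR (fact n))); set (L := RtoC (ln (INR n))).
assert (HI : cderiv (fun y => / pochhammer y (S n)) z
  (pochhammer z (S n) * S1 z (S n) * - / (pochhammer z (S n) * pochhammer z (S n)))).
{ apply (cderiv_comp (fun y => pochhammer y (S n)) Cinv); auto using cderiv_inv. }
assert (HE : cderiv (fun y => c * Cexp (y * L)) z (c * (L * Cexp (L * z)))).
{ apply (cderiv_ext (fun y => c * Cexp (L * y))).
  - intros y; now rewrite (Cmult_comm L).
  - apply cderiv_scal, cderiv_Cexp_scal. }
pose proof (cderiv_mult _ _ _ _ _ HE HI) as H.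
rewrite (Cmult_comm L z) in H.
replace (c * Cexp (z * L) / pochhammer z (S n) * (L - S1 z (S n))) with
  (c * (L * Cexp (z * L)) * / pochhammer z (S n) +
   c * Cexp (z * L) *
     (pochhammer z (S n) * S1 z (S n) * - / (pochhammer z (S n) * pochhammer z (S n))))
  by (field; auto).
exact H.
Qed.

Lemma cderiv_dlog_gamma_seq (n : nat) (z : C) :
  (forall k, z + RtoC (INR k) <> 0) ->
  cderiv (dlog_gamma_seq n) z (S2 z (S n)).
Proof.
intros Hz; unfold dlog_gamma_seq.
apply (cderiv_ext (fun y => RtoC (ln (INR n)) + (- (1)) * S1 y (S n))); [intros; ring|].
replace (S2 z (S n)) with (0 + (- (1)) * - S2 z (S n)) by ring.
apply (cderiv_plus (fun _ => RtoC (ln (INR n)))); [apply cderiv_const|].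
apply cderiv_scal, cderiv_S1; auto.
Qed.

(** The increment is [ln ((n + 2) / (n + 1)) - 1 / (n + 2)], at most [tele n], plus
    [z / ((n + 2) (z + n + 2))], at most [R0 * tele n] in modulus. *)
Lemma dlog_gamma_seq_step (n : nat) (z : C) (R0 : R) :
  (0 <= Re z)%R -> (Cmod z < R0)%R ->
  (Cmod (dlog_gamma_seq (S (S n)) z - dlog_gamma_seq (S n) z)%C <= (1 + R0) * tele n)%R.
Proof.
intros Hz HR; pose proof (pos_INR n) as Hn; pose proof (Cmod_ge_0 z) as Hz0.
destruct (ln_step_bounds n) as [L1 L2].
pose proof (Cmod_shift_ge z (INR n + 2) Hz ltac:(lra)) as Hge.
assert (Hn2 : RtoC (INR n + 2) <> 0) by (intros E; apply RtoC_inj in E; lra).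
assert (Hz2 : z + RtoC (INR n + 2) <> 0) by (apply Cmod_gt_0; lra).
unfold dlog_gamma_seq.
change (S1 z (S (S (S n)))) with (S1 z (S (S n)) + / (z + RtoC (INR (S (S n))))).
assert (E2 : INR (S (S n)) = (INR n + 2)%R) by (rewrite !S_INR; ring).
rewrite E2, (S_INR n).
replace (RtoC (ln (INR n + 2)) - (S1 z (S (S n)) + / (z + RtoC (INR n + 2)))
   - (RtoC (ln (INR n + 1)) - S1 z (S (S n)))) with
  ((RtoC (ln (INR n + 2)) - RtoC (ln (INR n + 1)) - / RtoC (INR n + 2))
   + z / (RtoC (INR n + 2) * (z + RtoC (INR n + 2)))) by (field; auto).
eapply Rle_trans; [apply Cmod_triangle|].
rewrite <- RtoC_inv, <- !RtoC_minus, Cmod_R, Rabs_pos_eq by lra.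
rewrite Cmod_div, Cmod_mult, Cmod_R, Rabs_pos_eq by (try apply Cmult_neq_0; auto; lra).
assert (E3 : (Cmod z / ((INR n + 2) * Cmod (z + RtoC (INR n + 2))) <= R0 * tele n)%R).
{ unfold Rdiv; apply Rmult_le_compat; try lra.
  - apply Rlt_le, Rinv_0_lt_compat; nra.
  - unfold tele.
    replace (/ (INR n + 1) - / (INR n + 2))%R with (/ ((INR n + 1) * (INR n + 2)))%R
      by (field; lra).
    apply Rinv_le_contravar; nra. }
unfold tele in *; lra.
Qed.

Lemma rsum_dlog_bound (R0 : R) (n : nat) :
  (0 <= R0)%R -> (rsum (fun n => (1 + R0) * tele n) n <= 1 + R0)%R.
Proof. intros H; rewrite rsum_scal; pose proof (rsum_tele_le n); nra. Qed.

Lemma cvg_step_bound (u : nat -> C) (v : nat -> R) :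
  (forall n, Cmod (u (S n) - u n)%C <= v n)%R ->
  forall n, (Cmod (u n) <= Cmod (u 0%nat) + rsum v n)%R.
Proof.
intros H; induction n as [|n IH]; simpl; [lra|].
eapply Rle_trans; [apply (Cmod_le_trans _ (u n))|]; specialize (H n); lra.
Qed.

Lemma Cmod_inv_shift_le (z : C) (k : nat) :
  (1 <= Re z)%R -> (Cmod (/ (z + RtoC (INR k))) <= / (INR k + 1))%R.
Proof.
intros Hz; pose proof (pos_INR k).
rewrite Cmod_inv by (apply Re_pos_shift_neq_0; lra).
pose proof (Re_le_Cmod_shift z k); apply Rinv_le_contravar; lra.
Qed.

(** The first term contributes at most [2], and all later increments together at most [1 + R0]. *)
Lemma dlog_gamma_seq_bound (n : nat) (z : C) (R0 : R) :
  (1 <= Re z)%R -> (Cmod z < R0)%R -> (Cmod (dlog_gamma_seq (S n) z) <= 3 + R0)%R.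
Proof.
intros Hz HR; pose proof (Cmod_ge_0 z) as Hz0.
pose proof (cvg_step_bound (fun n => dlog_gamma_seq (S n) z) (fun n => (1 + R0) * tele n)%R
  (fun n => dlog_gamma_seq_step n z R0 ltac:(lra) HR) n) as H.
pose proof (rsum_dlog_bound R0 n ltac:(lra)) as H1.
assert (H0 : (Cmod (dlog_gamma_seq 1 z) <= 2)%R).
{ unfold dlog_gamma_seq, S1; cbn [csum]; change (INR 1) with 1%R; rewrite ln_1.
  pose proof (Cmod_inv_shift_le z 0 Hz) as B0; pose proof (Cmod_inv_shift_le z 1 Hz) as B1.
  change (INR 1) with 1%R in B1; simpl INR in *.
  replace (RtoC 0 - (RtoC 0 + / (z + RtoC 0) + / (z + RtoC 1))) with
    (- (/ (z + RtoC 0) + / (z + RtoC 1))) by (rewrite !Cplus_0_l; ring).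
  rewrite Cmod_opp; eapply Rle_trans; [apply Cmod_triangle|]; lra. }
simpl in *; lra.
Qed.

Lemma S2_bound (n : nat) (z : C) : (1 <= Re z)%R -> (Cmod (S2 z n) <= 2)%R.
Proof.
intros Hz; apply Rle_trans with (rsum (fun k => 2 * tele k)%R n).
- apply Cmod_csum_le; intros k _.
  eapply Rle_trans; [|apply inv_sqr_le_tele].
  pose proof (pos_INR k) as Hk.
  assert (Hne := Re_pos_shift_neq_0 z k ltac:(lra)).
  rewrite Cmod_inv by (now apply Cmult_neq_0); rewrite Cmod_mult.
  pose proof (Re_le_Cmod_shift z k); apply Rinv_le_contravar; unfold Rsqr; nra.
- rewrite rsum_scal; pose proof (rsum_tele_le n); lra.
Qed.

Lemma euler_gamma_seq_bound (n : nat) (z : C) (R0 : R) :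
  (1 <= Re z)%R -> (Cmod z < R0)%R ->
  (Cmod (euler_gamma_seq (S n) z) <= exp (gamma_const R0))%R.
Proof.
intros Hz HR; pose proof (Cmod_ge_0 z) as Hz0.
assert (Hk := fun k => Re_pos_shift_neq_0 z k ltac:(lra)).
eapply Rle_trans; [apply (product_bound (fun n => euler_gamma_seq (S n) z)
  (fun n => gamma_step n z) (fun n => gamma_const R0 * tele n)%R)|].
- intros m; now apply euler_gamma_seq_step.
- intros m; apply gamma_step_bound; lra.
- rewrite <- (Rmult_1_l (exp (gamma_const R0))).
  apply Rmult_le_compat; try apply Cmod_ge_0; try apply Rlt_le, exp_pos.
  (* The product starts at [1 / (z (z + 1))], of modulus at most [1] when [1 <= Re z]. *)
  + unfold euler_gamma_seq, RCpower; change (INR 1) with 1%R; rewrite ln_1.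
    replace (z * RtoC 0) with (RtoC 0) by ring; rewrite Cexp_0.
    assert (Hp := pochhammer_neq_0 z 2 (fun k _ => Hk k)).
    change (INR (fact 1)) with 1%R.
    replace (RtoC 1 * 1 / pochhammer z 2) with (/ (z + RtoC (INR 0)) * / (z + RtoC (INR 1))).
    * rewrite Cmod_mult.
      pose proof (Cmod_inv_shift_le z 0 Hz) as B0; pose proof (Cmod_inv_shift_le z 1 Hz) as B1.
      change (INR 1) with 1%R in *; simpl INR in *.
      pose proof (Cmod_ge_0 (/ (z + RtoC 0))); pose proof (Cmod_ge_0 (/ (z + RtoC 1))).
      rewrite Rplus_0_l, Rinv_1 in B0; nra.
    * cbn [pochhammer] in *; field; repeat split; auto.
  + destruct (rsum_gamma_const R0 n ltac:(lra)) as [H|H];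
      [now apply Rlt_le, exp_increasing|rewrite H; lra].
Qed.

(* Two units to the right of the imaginary axis a whole unit ball stays in [1 <= Re z]. *)
Lemma cderiv_CGamma_right (x : C) :
  (2 <= Re x)%R -> exists l, cderiv CGamma x l.
Proof.
intros Hx; set (R0 := (Cmod x + 1)%R).
assert (HB : forall y, (Cmod (y - x) < 1)%R -> (1 <= Re y)%R /\ (Cmod y < R0)%R).
{ intros y Hy; split.
  - pose proof (re_le_Cmod (y - x)) as H; destruct x as [a b], y as [c d]; simpl in *.
    apply Rabs_le_between in H; lra.
  - unfold R0; pose proof (Cmod_triangle_inv y x); lra. }
assert (Hx0 : (Cmod (x - x) < 1)%R)
  by (replace (x - x) with (RtoC 0) by ring; rewrite Cmod_0; lra).
destruct (HB x Hx0) as [Hx1 HxR].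
assert (HR0 : (0 <= R0)%R) by (pose proof (Cmod_ge_0 x); lra).
destruct (cvg_of_abs_summable (fun n => dlog_gamma_seq (S n) x) (fun n => (1 + R0) * tele n)%R
  (1 + R0)) as [d Hd].
{ intros n; apply dlog_gamma_seq_step; lra. }
{ intros n; now apply rsum_dlog_bound. }
(* [d], the limit of the logarithmic derivatives of Euler's sequence, is the future value of
   [digamma x]. *)
exists (CGamma x * d).
apply (cderiv_of_cvg (fun n => euler_gamma_seq (S n))
  (fun n z => euler_gamma_seq (S n) z * dlog_gamma_seq (S n) z)
  (fun n z => euler_gamma_seq (S n) z
     * (dlog_gamma_seq (S n) z * dlog_gamma_seq (S n) z + S2 z (S (S n))))
  _ _ _ 1 (exp (gamma_const R0) * ((3 + R0) * (3 + R0) + 2))%R); [lra| | |].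
- intros n y Hy; destruct (HB y Hy) as [Hy1 HyR].
  assert (Hk := fun k => Re_pos_shift_neq_0 y k ltac:(lra)).
  split; [|split].
  + now apply cderiv_euler_gamma_seq.
  + apply cderiv_log_second; [now apply cderiv_euler_gamma_seq|].
    now apply cderiv_dlog_gamma_seq.
  + rewrite Cmod_mult; apply Rmult_le_compat; try apply Cmod_ge_0.
    * now apply euler_gamma_seq_bound.
    * eapply Rle_trans; [apply Cmod_triangle|]; rewrite Cmod_mult.
      pose proof (dlog_gamma_seq_bound n y R0 Hy1 HyR).
      pose proof (Cmod_ge_0 (dlog_gamma_seq (S n) y)).
      pose proof (S2_bound (S (S n)) y Hy1).
      apply Rplus_le_compat; [apply Rmult_le_compat|]; lra.
- intros y Hy; destruct (HB y Hy) as [Hy1 HyR].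
  apply (cvg_subseq (fun n => euler_gamma_seq n y) _ S); auto.
  apply euler_gamma_seq_cvg; lra.
- apply cvg_mult; auto.
  apply (cvg_subseq (fun n => euler_gamma_seq n x) _ S); auto.
  apply euler_gamma_seq_cvg; lra.
Qed.

(** * Functional equation of Gamma and extension to the left *)

Lemma cvg_inv_INR : cvg (fun n => / RtoC (INR n)) 0.
Proof.
apply (cvg_squeeze _ _ (fun n => / INR n)%R 1).
- intros n Hn; replace (/ RtoC (INR n) - 0) with (/ RtoC (INR n)) by ring.
  assert (H : (0 < INR n)%R) by (apply lt_0_INR; lia).
  rewrite <- RtoC_inv, Cmod_R, Rabs_pos_eq by (try apply Rlt_le, Rinv_0_lt_compat; lra).
  lra.
- replace (Finite 0) with (Rbar_inv p_infty) by reflexivity.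
  apply is_lim_seq_inv; [apply is_lim_seq_INR|discriminate].
Qed.

(** [CGamma] is total; this records that its value at [z] is a genuine limit. It is needed on whole
    balls, since only then can derivatives be transported by the functional equation. *)
Definition gamma_regular (z : C) : Prop :=
  (forall k, z + RtoC (INR k) <> 0)
  /\ cvg (fun n => euler_gamma_seq n z) (CGamma z).

(** Euler's term at [z] is the term at [z + 1] times [(z + n + 1) / (z n) = 1 / z + (z + 1) / (z
    n)], so convergence moves from [z + 1] to [z] and brings the functional equation with it. *)
Lemma gamma_regular_pred (z : C) :
  z <> 0 -> gamma_regular (z + 1) -> gamma_regular z /\ CGamma (z + 1) = z * CGamma z.
Proof.
intros Hz [Hk Hc].
assert (Hk' : forall k, z + RtoC (INR k) <> 0).
{ intros [|k]; [simpl; now rewrite Cplus_0_r|].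
  rewrite RtoC_INR_S.
  replace (z + (RtoC (INR k) + 1)) with (z + 1 + RtoC (INR k)) by ring; auto. }
assert (H : cvg (fun n => euler_gamma_seq n z) (CGamma (z + 1) * (/ z + (z + 1) / z * 0))).
{ apply (cvg_ext_loc (fun n => euler_gamma_seq n (z + 1)
     * (/ z + (z + 1) / z * / RtoC (INR n))) _ _ 1).
  - intros n Hn.
    assert (Hn0 : (0 < INR n)%R) by (apply lt_0_INR; lia).
    assert (HnC : RtoC (INR n) <> 0) by (intros E; apply RtoC_inj in E; lra).
    assert (Hp := pochhammer_neq_0 (z + 1) (S n) (fun k _ => Hk k)).
    assert (Hp' := pochhammer_neq_0 z (S n) (fun k _ => Hk' k)).
    assert (E := pochhammer_succ_l z (S n)).
    change (pochhammer z (S (S n))) with (pochhammer z (S n) * (z + RtoC (INR (S n)))) in E.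
    assert (HSn := Hk' (S n)).
    rewrite RtoC_INR_S in E, HSn.
    unfold euler_gamma_seq, RCpower.
    replace (Cexp ((z + 1) * RtoC (ln (INR n)))) with
      (Cexp (z * RtoC (ln (INR n))) * RtoC (INR n)).
    2:{ rewrite <- (exp_ln (INR n)) at 2 by auto.
        rewrite <- Cexp_RtoC, <- Cexp_plus; f_equal; ring. }
    set (P := pochhammer (z + 1) (S n)) in *; set (Q := pochhammer z (S n)) in *.
    replace P with (Q * (z + (RtoC (INR n) + 1)) / z) by (rewrite E; field; auto).
    field; repeat split; auto.
  - apply cvg_mult; auto.
    apply cvg_plus; [apply cvg_const|apply cvg_scal, cvg_inv_INR]. }
assert (E : CGamma z = CGamma (z + 1) / z).
{ rewrite (cvg_CLim_seq _ _ H : CGamma z = _); field; auto. }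
split.
- split; auto; rewrite E.
  now replace (CGamma (z + 1) / z) with (CGamma (z + 1) * (/ z + (z + 1) / z * 0))
    by (field; auto).
- rewrite E; field; auto.
Qed.

(** One unit step to the left through [CGamma y = CGamma (y + 1) / y], valid on a ball around [z]
    whose radius is at most [Cmod z], so that it avoids [0]. *)
Lemma CGamma_derivable_pred (z : C) (r : R) :
  (0 < r)%R -> z <> 0 ->
  (forall y, (Cmod (y - (z + 1)) < r)%R -> gamma_regular y) ->
  CGamma (z + 1) <> 0 ->
  (exists l, cderiv CGamma (z + 1) l) ->
  (exists r', (0 < r')%R /\ forall y, (Cmod (y - z) < r')%R -> gamma_regular y)
  /\ CGamma z <> 0 /\ (exists l, cderiv CGamma z l).
Proof.
intros Hr Hz Hreg Hne [l Hl].
assert (Hz0 : (0 < Cmod z)%R) by now apply Cmod_gt_0.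
assert (Hloc : forall y, (Cmod (y - z) < Rmin r (Cmod z))%R ->
  y <> 0 /\ gamma_regular (y + 1)).
{ intros y Hy; split.
  - pose proof (Rmin_r r (Cmod z)); rewrite Cmod_sub_sym in Hy.
    pose proof (Cmod_triangle_inv z y); apply Cmod_gt_0; lra.
  - apply Hreg; replace (y + 1 - (z + 1)) with (y - z) by ring.
    pose proof (Rmin_l r (Cmod z)); lra. }
assert (Hzz : (Cmod (z - z) < Rmin r (Cmod z))%R).
{ replace (z - z) with (RtoC 0) by ring; rewrite Cmod_0; now apply Rmin_pos. }
assert (Hpos : (0 < Rmin r (Cmod z))%R) by now apply Rmin_pos.
split; [|split].
- exists (Rmin r (Cmod z)); split; auto.
  intros y Hy; destruct (Hloc y Hy); now apply gamma_regular_pred.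
- destruct (Hloc z Hzz) as [_ H]; destruct (gamma_regular_pred z Hz H) as [_ E].
  intros E0; apply Hne; rewrite E, E0; ring.
- exists (1 * l * / z + CGamma (z + 1) * - / (z * z)).
  apply (cderiv_ext_loc (fun y => CGamma (y + 1) * / y) _ _ _ (Rmin r (Cmod z))); auto.
  + intros y Hy; destruct (Hloc y Hy) as [Hy0 H].
    destruct (gamma_regular_pred y Hy0 H) as [_ E]; rewrite E; field; auto.
  + apply (cderiv_mult (fun y => CGamma (y + 1))); [|now apply cderiv_inv].
    apply (cderiv_comp (fun y => y + 1) CGamma); auto using cderiv_shift.
Qed.

(** Induction on a number of unit steps that suffices to bring [z] into [2 <= Re z]. *)
Lemma CGamma_regular (z : C) :
  (forall k, z + RtoC (INR k) <> 0) ->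
  (exists r, (0 < r)%R /\ forall y, (Cmod (y - z) < r)%R -> gamma_regular y)
  /\ CGamma z <> 0 /\ (exists l, cderiv CGamma z l).
Proof.
destruct (nfloor_ex (Rabs (2 - Re z))) as [m Hm]; [apply Rabs_pos|].
assert (Hm' : (2 - INR (S m) <= Re z)%R).
{ rewrite S_INR; pose proof (Rle_abs (2 - Re z)); lra. }
clear Hm; revert z Hm'; generalize (S m); clear m.
intros m; induction m as [|m IH]; intros z Hm Hk.
- simpl in Hm; split; [|split].
  + exists 1%R; split; [lra|]; intros y Hy.
    assert (Hy1 : (0 < Re y)%R).
    { pose proof (re_le_Cmod (y - z)) as H; destruct z as [a b], y as [c d]; simpl in *.
      apply Rabs_le_between in H; lra. }
    split; [intros k; now apply Re_pos_shift_neq_0|now apply euler_gamma_seq_cvg].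
  + apply euler_gamma_seq_cvg; lra.
  + apply cderiv_CGamma_right; lra.
- assert (Hz : z <> 0) by (specialize (Hk 0%nat); simpl in Hk; now rewrite Cplus_0_r in Hk).
  destruct (IH (z + 1)) as ([r [Hr Hreg]] & Hne & Hd).
  + rewrite S_INR in Hm; destruct z; simpl in *; lra.
  + intros k; replace (z + 1 + RtoC (INR k)) with (z + RtoC (INR (S k)))
      by (rewrite RtoC_INR_S; ring); auto.
  + now apply (CGamma_derivable_pred z r).
Qed.

(** The derivative of [CGamma (y + 1)] at [z], computed by the chain rule and through
    [y * CGamma y], has only one value. *)
Lemma digamma_succ (z : C) :
  (forall k, z + RtoC (INR k) <> 0) -> digamma (z + 1) = digamma z + / z.
Proof.
intros Hk.
assert (Hz : z <> 0) by (pose proof (Hk 0%nat) as H; simpl in H; now rewrite Cplus_0_r in H).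
assert (Hk1 : forall k, z + 1 + RtoC (INR k) <> 0).
{ intros k; replace (z + 1 + RtoC (INR k)) with (z + RtoC (INR (S k)))
      by (rewrite RtoC_INR_S; ring); auto. }
destruct (CGamma_regular z Hk) as (_ & Hne & [l Hl]).
destruct (CGamma_regular (z + 1) Hk1) as ([r [Hr Hreg]] & Hne1 & [l1 Hl1]).
assert (Hz0 : (0 < Cmod z)%R) by now apply Cmod_gt_0.
assert (HD : cderiv (fun y => CGamma (y + 1)) z (1 * CGamma z + z * l)).
{ apply (cderiv_ext_loc (fun y => y * CGamma y) _ _ _ (Rmin r (Cmod z))).
  - now apply Rmin_pos.
  - intros y Hy; symmetry; apply gamma_regular_pred.
    + pose proof (Rmin_r r (Cmod z)); rewrite Cmod_sub_sym in Hy.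
      pose proof (Cmod_triangle_inv z y); apply Cmod_gt_0; lra.
    + apply Hreg; replace (y + 1 - (z + 1)) with (y - z) by ring.
      pose proof (Rmin_l r (Cmod z)); lra.
  - apply (cderiv_mult (fun y => y)); auto using cderiv_id. }
assert (HD1 : cderiv (fun y => CGamma (y + 1)) z (1 * l1)).
{ apply (cderiv_comp (fun y => y + 1) CGamma); auto using cderiv_shift. }
assert (E : l1 = CGamma z + z * l).
{ rewrite <- (Cmult_1_l l1).
  rewrite <- (is_C_derive_unique _ _ _ (cderiv_is_derive _ _ _ HD1)).
  rewrite (is_C_derive_unique _ _ _ (cderiv_is_derive _ _ _ HD)); ring. }
assert (EG : CGamma (z + 1) = z * CGamma z).
{ apply gamma_regular_pred; auto; apply Hreg.
  replace (z + 1 - (z + 1)) with (RtoC 0) by ring; now rewrite Cmod_0. }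
unfold digamma.
rewrite (is_C_derive_unique _ _ _ (cderiv_is_derive _ _ _ Hl1)).
rewrite (is_C_derive_unique _ _ _ (cderiv_is_derive _ _ _ Hl)).
rewrite E, EG; field; auto.
Qed.

Lemma digamma_add_nat (z : C) (n : nat) :
  (forall k, z + RtoC (INR k) <> 0) ->
  digamma (z + RtoC (INR n)) = digamma z + S1 z n.
Proof.
intros Hk; induction n as [|n IH].
- unfold S1; simpl; now rewrite !Cplus_0_r.
- rewrite RtoC_INR_S, Cplus_assoc, digamma_succ, IH; [unfold S1; simpl; ring|].
  intros k; rewrite <- Cplus_assoc, <- RtoC_plus, <- plus_INR; auto.
Qed.

(** * The binomial series at cube roots of unity *)

(* [bc b n] is the coefficient of [x^n] in [(1 - x)^(-b)]. *)
Definition bc (b : C) (n : nat) : C := pochhammer b n / RtoC (INR (fact n)).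

Lemma RtoC_INR_neq_0 (n : nat) : (0 < n)%nat -> RtoC (INR n) <> 0.
Proof. intros H E; apply RtoC_inj in E; apply lt_0_INR in H; lra. Qed.

Lemma RtoC_fact_neq_0 (n : nat) : RtoC (INR (fact n)) <> 0.
Proof. apply RtoC_INR_neq_0, lt_O_fact. Qed.

Lemma bc_0 (b : C) : bc b 0 = 1.
Proof. unfold bc; simpl; field. Qed.

Lemma bc_succ (b : C) (n : nat) :
  bc b (S n) = bc b n * (b + RtoC (INR n)) / RtoC (INR (S n)).
Proof.
unfold bc; change (fact (S n)) with (S n * fact n)%nat.
rewrite mult_INR, RtoC_mult; simpl pochhammer.
field; split; [apply RtoC_fact_neq_0|apply RtoC_INR_neq_0; lia].
Qed.

Lemma bc_succ_scal (b : C) (n : nat) :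
  RtoC (INR (S n)) * bc b (S n) = b * bc (b + 1) n.
Proof.
unfold bc; change (fact (S n)) with (S n * fact n)%nat.
rewrite mult_INR, RtoC_mult, pochhammer_succ_l.
field; split; [apply RtoC_fact_neq_0|apply RtoC_INR_neq_0; lia].
Qed.

(** Dividing [(1 - x)^(-b)] by [1 - x] sums its coefficients and replaces [b] by [b + 1].
    Convergence at [x = 1] thus reduces to the decay of a single coefficient. *)
Lemma csum_bc (b : C) (n : nat) : csum (bc b) (S n) = bc (b + 1) n.
Proof.
induction n as [|n IH]; [simpl; rewrite !bc_0; ring|].
change (csum (bc b) (S (S n))) with (csum (bc b) (S n) + bc b (S n)).
assert (HS : RtoC (INR (S n)) <> 0) by (apply RtoC_INR_neq_0; lia).
rewrite IH, (bc_succ (b + 1)).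
replace (bc b (S n)) with (b * bc (b + 1) n / RtoC (INR (S n)))
  by (rewrite <- bc_succ_scal; field; auto).
rewrite RtoC_INR_S in *; field; auto.
Qed.

(** * Decay of the binomial coefficients *)

(** In [|b + x|^2 = |b|^2 + 2 x Re b + x^2], half of the gain [- 4 c x] absorbs [|b|^2] and the
    other half leads to [(x - c)^2]. The summand [c] in the threshold makes [x - c] nonnegative. *)
Lemma Cmod_shift_le (b : C) (c R0 x : R) :
  (0 < c)%R -> (Re b <= - 2 * c)%R -> (Cmod b <= R0)%R ->
  (R0 * R0 / (2 * c) + c <= x)%R -> (Cmod (b + RtoC x) <= x - c)%R.
Proof.
intros Hc Hre HR Hx; pose proof (Cmod_ge_0 b) as Hb.
assert (HRR : (0 <= R0 * R0 / (2 * c))%R) by (apply Rdiv_le_0_compat; nra).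
assert (Hx' : (R0 * R0 <= x * (2 * c))%R) by (apply Rle_div_l; lra).
apply Rsqr_incr_0_var; [|lra].
pose proof (Cmod2_alt (b + RtoC x)) as E; pose proof (Cmod2_alt b) as Eb.
replace (Re (b + RtoC x)) with (Re b + x)%R in E by (destruct b; reflexivity).
replace (Im (b + RtoC x)) with (Im b) in E by (destruct b; simpl; ring).
unfold Rsqr; simpl in E, Eb; nra.
Qed.

Lemma bc_step (b : C) (n : nat) :
  (INR (S n) * Cmod (bc b (S n)) = Cmod (b + RtoC (INR n))%C * Cmod (bc b n))%R.
Proof.
assert (HS : (0 < INR (S n))%R) by (apply lt_0_INR; lia).
rewrite bc_succ, Cmod_div, Cmod_mult, Cmod_R, Rabs_pos_eq
  by (try lra; apply RtoC_INR_neq_0; lia).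
field; lra.
Qed.

Lemma is_lim_seq_exp_ln (c : R) :
  (0 < c)%R -> is_lim_seq (fun n => exp (- c * ln (INR n + 1)))%R 0.
Proof.
intros Hc.
apply (is_lim_comp_seq exp _ m_infty 0).
- apply is_lim_exp_m.
- exists 0%nat; discriminate.
- replace m_infty with (Rbar_mult (Finite (- c)%R) p_infty).
  + apply is_lim_seq_scal_l.
    apply (is_lim_comp_seq ln _ p_infty p_infty).
    * apply is_lim_ln_p.
    * exists 0%nat; discriminate.
    * apply (is_lim_seq_ext (fun n => INR (S n))); [intros n; apply S_INR|].
      apply (is_lim_seq_incr_1 INR), is_lim_seq_INR.
  + simpl; destruct (Rle_dec 0 (- c)); [exfalso; lra|reflexivity].
Qed.

(** The ratio of consecutive moduli is eventually at most
    [1 - c / (n + 1) <= ((n + 1) / (n + 2))^c], so the coefficients decay at least like [n^(-c)]. *)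
Lemma bc_lim_0 (b : C) :
  (Re b < 0)%R -> is_lim_seq (fun n => Cmod (bc (b + 1) n)) 0.
Proof.
intros Hb; set (c := (- Re b / 2)%R); assert (Hc : (0 < c)%R) by (unfold c; lra).
pose proof (Cmod_ge_0 b) as Hb0.
assert (Hq : (0 <= Cmod b * Cmod b / (2 * c) + c)%R).
{ apply Rplus_le_le_0_compat; [apply Rdiv_le_0_compat; nra|lra]. }
destruct (nfloor_ex _ Hq) as [N HN].
(* Normalised so that the bound is an equality at [n = S N]. *)
set (V := (Cmod (bc (b + 1) (S N)) / exp (- c * ln (INR (S N) + 1)))%R).
assert (Hstep : forall n, (S N <= n)%nat ->
  (Cmod (bc (b + 1) n) <= V * exp (- c * ln (INR n + 1)))%R).
{ induction 1 as [|n Hn IH].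
  - unfold V; right; field; apply Rgt_not_eq, exp_pos.
  - assert (HnN : (INR (S N) <= INR n)%R) by now apply le_INR.
    rewrite S_INR in HnN; pose proof (pos_INR N).
    pose proof (bc_step (b + 1) n) as E.
    assert (Hle : (Cmod (b + 1 + RtoC (INR n)) <= INR n + 1 - c)%R).
    { replace (b + 1 + RtoC (INR n)) with (b + RtoC (INR n + 1)) by (rewrite RtoC_plus; ring).
      apply (Cmod_shift_le b c (Cmod b)); unfold c in *; lra. }
    rewrite S_INR in E |- *.
    assert (Hlog := proj2 (ln_step_bounds n)).
    assert (He : ((INR n + 1 - c) / (INR n + 1)
                 <= exp (- c * (ln (INR n + 2) - ln (INR n + 1))))%R).
    { eapply Rle_trans; [|apply exp_ineq1_le].
      replace ((INR n + 1 - c) / (INR n + 1))%R with (1 + - c * / (INR n + 1))%R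
        by (field; lra).
      apply Rplus_le_compat_l, Rmult_le_compat_neg_l; lra. }
    replace (exp (- c * ln (INR n + 1 + 1)))%R with
      (exp (- c * (ln (INR n + 2) - ln (INR n + 1))) * exp (- c * ln (INR n + 1)))%R.
    2:{ rewrite <- exp_plus; f_equal; replace (INR n + 1 + 1)%R with (INR n + 2)%R by ring; ring. }
    replace (Cmod (bc (b + 1) (S n))) with
      (Cmod (b + 1 + RtoC (INR n)) / (INR n + 1) * Cmod (bc (b + 1) n))%R.
    2:{ unfold Rdiv; rewrite Rmult_assoc, (Rmult_comm (/ _)), <- Rmult_assoc, <- E.
        field; lra. }
    replace (V * (exp (- c * (ln (INR n + 2) - ln (INR n + 1))) * exp (- c * ln (INR n + 1))))%R
      with (exp (- c * (ln (INR n + 2) - ln (INR n + 1))) * (V * exp (- c * ln (INR n + 1))))%R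
      by ring.
    apply Rmult_le_compat; auto using Cmod_ge_0.
    + apply Rdiv_le_0_compat; [apply Cmod_ge_0|lra].
    + eapply Rle_trans; [|exact He].
      apply Rmult_le_compat_r; [apply Rlt_le, Rinv_0_lt_compat; lra|auto]. }
apply (is_lim_seq_0_le _ (fun n => V * exp (- c * ln (INR n + 1)))%R (S N)).
- intros n Hn; split; [apply Cmod_ge_0|auto].
- now apply is_lim_seq_scal_0, is_lim_seq_exp_ln.
Qed.

Lemma cvg_csum_bc (b : C) : (Re b < 0)%R -> cvg (csum (bc b)) 0.
Proof.
intros Hb; apply cvg_incr_1.
apply (cvg_squeeze _ _ (fun n => Cmod (bc (b + 1) n)) 0); [|now apply bc_lim_0].
intros n _; rewrite csum_bc; replace (bc (b + 1) n - 0) with (bc (b + 1) n) by ring; lra.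
Qed.

(** * Summation in the closed unit disc and at the cube roots of unity *)

Lemma cderiv_pow (n : nat) (x : C) :
  cderiv (fun y => y ^ n) x (RtoC (INR n) * x ^ pred n).
Proof.
induction n as [|n IH].
- simpl; rewrite Cmult_0_l; apply cderiv_const.
- rewrite RtoC_INR_S; simpl pred.
  replace ((RtoC (INR n) + 1) * x ^ n) with
    (1 * x ^ n + x * (RtoC (INR n) * x ^ pred n)).
  + simpl; apply (cderiv_mult (fun y => y) (fun y => y ^ n)); auto using cderiv_id.
  + destruct n; simpl; ring.
Qed.

(** [(1 - x)^(-b)] solves [(1 - x) y' = b y]; truncating its expansion leaves a single term as
    defect. *)
Lemma bc_poly_ode (b x : C) (n : nat) :
  b * csum (fun k => bc b k * x ^ k) n
  - (1 - x) * csum (fun k => bc b k * (RtoC (INR k) * x ^ pred k)) n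
  = RtoC (INR n) * bc b n * x ^ pred n.
Proof.
induction n as [|n IH]; [simpl; ring|].
cbn [csum]; cbv beta.
set (A := csum (fun k => bc b k * x ^ k) n) in *.
set (B := csum (fun k => bc b k * (RtoC (INR k) * x ^ pred k)) n) in *.
transitivity ((b * A - (1 - x) * B) +
  bc b n * (b * x ^ n - (1 - x) * (RtoC (INR n) * x ^ pred n))); [ring|].
rewrite IH, bc_succ; simpl (pred (S n)).
assert (HS : RtoC (INR (S n)) <> 0) by (apply RtoC_INR_neq_0; lia).
transitivity (bc b n * (b + RtoC (INR n)) * x ^ n); [|field; auto].
destruct n; simpl; ring.
Qed.

(* With [x = 1 - exp (lam s)] the product [exp (b lam s) F_n(x)] of the candidate inverse and the
   [n]-th partial sum has derivative [lam exp (b lam s) n bc_n x^(n-1)], which tends to [0] uniformly. *)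
Lemma cvg_power_sum (b lam : C) :
  (Re b < 0)%R ->
  (forall t : R, 0 <= t <= 1 -> Cmod (1 - Cexp (lam * RtoC t))%C <= 1)%R ->
  cvg (csum (fun k => bc b k * (1 - Cexp lam) ^ k)) (Cexp (- (b * lam))).
Proof.
intros Hb Hlam.
set (F := fun n x => csum (fun k => bc b k * x ^ k) n).
set (dF := fun n x => csum (fun k => bc b k * (RtoC (INR k) * x ^ pred k)) n).
set (X := fun s => 1 - Cexp (lam * s)).
set (G := fun n s => Cexp (b * lam * s) * F n (X s)).
set (dG := fun n s => lam * Cexp (b * lam * s) * (RtoC (INR n) * bc b n * X s ^ pred n)).
assert (HdF : forall n x, cderiv (F n) x (dF n x)).
{ intros n x; apply (cderiv_csum (fun k x => bc b k * x ^ k)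
    (fun k x => bc b k * (RtoC (INR k) * x ^ pred k))).
  intros k _; apply cderiv_scal, cderiv_pow. }
assert (HdX : forall s, cderiv X s (- (lam * Cexp (lam * s)))).
{ intros s; apply (cderiv_ext (fun s => 1 + (- (1)) * Cexp (lam * s))); [intros; unfold X; ring|].
  replace (- (lam * Cexp (lam * s))) with (0 + (- (1)) * (lam * Cexp (lam * s))) by ring.
  apply (cderiv_plus (fun _ => RtoC 1)); [apply cderiv_const|].
  apply cderiv_scal, cderiv_Cexp_scal. }
assert (HdG : forall n s, cderiv (G n) s (dG n s)).
{ intros n s; unfold dG.
  rewrite <- bc_poly_ode; fold (F n (X s)) (dF n (X s)).
  replace (lam * Cexp (b * lam * s) * (b * F n (X s) - (1 - X s) * dF n (X s))) with
    (b * lam * Cexp (b * lam * s) * F n (X s)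
     + Cexp (b * lam * s) * (- (lam * Cexp (lam * s)) * dF n (X s)))
    by (unfold X; ring).
  apply (cderiv_mult (fun s => Cexp (b * lam * s)) (fun s => F n (X s))).
  - apply cderiv_Cexp_scal.
  - apply (cderiv_comp X (F n)); auto. }
set (K := (Cmod lam * exp (Cmod (b * lam)))%R).
assert (HK : (0 <= K)%R).
{ apply Rmult_le_pos; [apply Cmod_ge_0|apply Rlt_le, exp_pos]. }
assert (Hbound : forall n, (Cmod (G n 1 - G n 0) <= 2 * (K * (INR n * Cmod (bc b n))))%R).
{ intros n.
  replace (2 * (K * (INR n * Cmod (bc b n))))%R with
    (2 * (K * (INR n * Cmod (bc b n))) * Cmod (1 - 0))%R
    by (replace (RtoC 1 - 0) with (RtoC 1) by ring; rewrite Cmod_1; ring).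
  apply (cderiv_mean_value (G n) (dG n)).
  intros t Ht; split; [apply HdG|].
  replace (0 + RtoC t * (1 - 0)) with (RtoC t) by ring.
  unfold dG; rewrite !Cmod_mult, Cmod_pow, Cmod_R, (Rabs_pos_eq (INR n)) by apply pos_INR.
  assert (Hx : (Cmod (X (RtoC t)) ^ pred n <= 1)%R).
  { rewrite <- (pow1 (pred n)); apply pow_incr; split; [apply Cmod_ge_0|now apply Hlam]. }
  assert (He : (Cmod (Cexp (b * lam * RtoC t)) <= exp (Cmod (b * lam)))%R).
  { rewrite Cmod_Cexp.
    assert (Hle : (Re (b * lam * RtoC t) <= Cmod (b * lam))%R).
    { eapply Rle_trans; [apply Rle_abs|]; eapply Rle_trans; [apply re_le_Cmod|].
      rewrite (Cmod_mult (b * lam)), Cmod_R, Rabs_pos_eq by lra.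
      pose proof (Cmod_ge_0 (b * lam)); nra. }
    destruct Hle as [H|H]; [now apply Rlt_le, exp_increasing|rewrite H; lra]. }
  unfold K; rewrite Rmult_assoc.
  assert (Hp : (0 <= Cmod (X (RtoC t)) ^ pred n)%R) by (apply pow_le, Cmod_ge_0).
  assert (Hq : (0 <= INR n * Cmod (bc b n))%R)
    by (apply Rmult_le_pos; [apply pos_INR|apply Cmod_ge_0]).
  rewrite (Rmult_assoc (Cmod lam)); apply Rmult_le_compat_l; [apply Cmod_ge_0|].
  apply Rmult_le_compat; auto using Cmod_ge_0; nra. }
(* At [x = 0] only the term [k = 0] survives; the empty partial sum would give [0], hence
   [1 <= n]. *)
assert (HG0 : forall n, (1 <= n)%nat -> G n 0 = 1).
{ intros n Hn; unfold G, F, X; rewrite !Cmult_0_r, Cexp_0.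
  replace (RtoC 1 - 1) with (RtoC 0) by ring.
  destruct n as [|n]; [lia|]; clear Hn.
  rewrite Cmult_1_l; induction n as [|n IH]; [simpl; rewrite bc_0; ring|].
  change (csum (fun k => bc b k * RtoC 0 ^ k) (S n) + bc b (S n) * RtoC 0 ^ (S n) = 1).
  rewrite IH; simpl; ring. }
assert (HG1 : cvg (fun n => G n 1) 1).
{ apply (cvg_squeeze _ _ (fun n => 2 * (K * (INR n * Cmod (bc b n))))%R 1).
  - intros n Hn; rewrite <- (HG0 n Hn) at 2; apply Hbound.
  (* After a shift of index, [bc_succ_scal] turns [n * bc b n] into [b * bc (b + 1) (n - 1)], which
     is known to tend to [0]. *)
  - apply is_lim_seq_scal_0, is_lim_seq_scal_0, is_lim_seq_incr_1.
    apply (is_lim_seq_ext (fun n => Cmod b * Cmod (bc (b + 1) n))%R).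
    + intros n; rewrite <- Cmod_mult, <- bc_succ_scal, Cmod_mult, Cmod_R, Rabs_pos_eq;
        [reflexivity|apply pos_INR].
    + now apply is_lim_seq_scal_0, bc_lim_0. }
apply (cvg_ext (fun n => Cexp (- (b * lam)) * G n 1)).
- intros n; unfold G, F, X; rewrite !Cmult_1_r, Cmult_assoc, <- Cexp_plus.
  replace (- (b * lam) + b * lam) with (RtoC 0) by ring; rewrite Cexp_0; ring.
- pose proof (cvg_scal _ (Cexp (- (b * lam))) _ HG1) as H.
  now rewrite Cmult_1_r in H.
Qed.

(* [1 - exp (root_log s)] is the primitive cube root of unity [(-1 + s i sqrt 3) / 2] when [s = 1] or [s = -1]. *)
Definition root_log (s : R) : C := (ln 3 / 2, - (s * (PI / 6)))%R.

Definition cube_root (s : R) : C := (- (1 / 2), s * (sqrt 3 / 2))%R.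

Lemma exp_half_ln3 : exp (ln 3 / 2) = sqrt 3.
Proof.
apply Rsqr_inj; [apply Rlt_le, exp_pos|apply sqrt_pos|].
rewrite Rsqr_sqrt by lra; unfold Rsqr; rewrite <- exp_plus.
replace (ln 3 / 2 + ln 3 / 2)%R with (ln 3) by field; apply exp_ln; lra.
Qed.

Lemma cos_sign (s x : R) : (s = 1 \/ s = -1)%R -> cos (s * x) = cos x.
Proof.
intros [->| ->]; [f_equal; ring|].
rewrite <- (cos_neg x); f_equal; ring.
Qed.

Lemma sin_sign (s x : R) : (s = 1 \/ s = -1)%R -> sin (s * x) = (s * sin x)%R.
Proof.
intros [->| ->]; [rewrite !Rmult_1_l; reflexivity|].
replace (-1 * x)%R with (- x)%R by ring; rewrite sin_neg; ring.
Qed.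

Lemma cube_root_log (s : R) :
  (s = 1 \/ s = -1)%R -> 1 - Cexp (root_log s) = cube_root s.
Proof.
intros Hs; unfold Cexp, root_log, cube_root, Cminus, Cplus, Copp, RtoC; simpl.
rewrite exp_half_ln3, cos_neg, sin_neg, cos_sign, sin_sign, cos_PI6, sin_PI6 by auto.
assert (H3 : (sqrt 3 * sqrt 3 = 3)%R) by (apply sqrt_sqrt; lra).
f_equal; [|field].
replace (1 + - (sqrt 3 * (sqrt 3 / 2)))%R with (1 - (sqrt 3 * sqrt 3) / 2)%R by field.
rewrite H3; field.
Qed.

(** The squared modulus is [1 - 2 e q + e^2] with [e = 3^(t/2)] and [q = cos (PI t / 6)]. It is at
    most [1] when [e <= 2 q], and indeed [e <= sqrt 3 <= 2 q] along the path. *)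
Lemma root_log_disc (s t : R) :
  (s = 1 \/ s = -1)%R -> (0 <= t <= 1)%R ->
  (Cmod (1 - Cexp (root_log s * RtoC t)) <= 1)%R.
Proof.
intros Hs Ht.
set (e := exp (ln 3 / 2 * t)); set (q := cos (PI / 6 * t)).
assert (Hln : (0 < ln 3)%R) by (rewrite <- ln_1; apply ln_increasing; lra).
assert (He : (0 < e <= sqrt 3)%R).
{ split; [apply exp_pos|]; rewrite <- exp_half_ln3; unfold e.
  assert (Hle : (ln 3 / 2 * t <= ln 3 / 2)%R) by nra.
  destruct Hle as [H|H]; [now apply Rlt_le, exp_increasing|rewrite H; lra]. }
assert (Hq : (sqrt 3 / 2 <= q)%R).
{ rewrite <- cos_PI6; unfold q; pose proof PI_RGT_0; apply cos_decr_1; nra. }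
assert (E : ((Cmod (1 - Cexp (root_log s * RtoC t))) ^ 2 = 1 - 2 * e * q + e * e)%R).
{ rewrite Cmod2_alt.
  replace (root_log s * RtoC t) with (((ln 3 / 2 * t)%R, (- (s * (PI / 6 * t)))%R) : C)
    by (unfold root_log, Cmult, RtoC; simpl; f_equal; ring).
  unfold Cexp, Cminus, Cplus, Copp, RtoC; simpl.
  rewrite cos_neg, sin_neg, cos_sign, sin_sign by auto; fold e q.
  pose proof (sin2_cos2 (PI / 6 * t)) as H2; unfold Rsqr in H2; fold q in H2.
  set (p := sin (PI / 6 * t)) in *.
  assert (Hss : (s * s = 1)%R) by (destruct Hs as [->| ->]; ring).
  replace (1 - 2 * e * q + e * e)%R with (1 - 2 * e * q + e * e * (p * p * (s * s) + q * q))%R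
    by (rewrite Hss, Rmult_1_r, H2; ring).
  ring. }
pose proof (Cmod_ge_0 (1 - Cexp (root_log s * RtoC t))).
set (m := Cmod _) in *.
assert (m ^ 2 <= 1)%R by (rewrite E; nra).
simpl in *; nra.
Qed.

Lemma cvg_bc_cube_root (b : C) (s : R) :
  (Re b < 0)%R -> (s = 1 \/ s = -1)%R ->
  cvg (csum (fun k => bc b k * cube_root s ^ k)) (Cexp (- (b * root_log s))).
Proof.
intros Hb Hs; rewrite <- (cube_root_log s Hs).
apply cvg_power_sum; auto; intros t Ht; now apply root_log_disc.
Qed.

Lemma cube_root_sqr (s : R) :
  (s = 1 \/ s = -1)%R -> cube_root s ^ 2 = - (1) - cube_root s.
Proof.
intros Hs; assert (H3 : (sqrt 3 * sqrt 3 = 3)%R) by (apply sqrt_sqrt; lra).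
assert (Hss : (s * s = 1)%R) by (destruct Hs as [->| ->]; ring).
simpl; unfold cube_root, Cmult, Cminus, Cplus, Copp, RtoC; simpl; f_equal.
- replace (- (1 / 2) * (- (1 / 2) * 1 - s * (sqrt 3 / 2) * 0) -
   s * (sqrt 3 / 2) * (- (1 / 2) * 0 + s * (sqrt 3 / 2) * 1))%R
   with (1 / 4 - (s * s) * (sqrt 3 * sqrt 3) / 4)%R by field.
  rewrite Hss, H3; field.
- field.
Qed.

Lemma cube_root_pow3 (s : R) (j : nat) :
  (s = 1 \/ s = -1)%R -> cube_root s ^ (3 * j) = 1.
Proof.
intros Hs; pose proof (cube_root_sqr s Hs) as H2.
assert (H3 : cube_root s ^ 3 = 1).
{ change (cube_root s * cube_root s ^ 2 = 1); rewrite H2.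
  transitivity (- cube_root s - cube_root s ^ 2); [simpl; ring|rewrite H2; ring]. }
rewrite Cpow_mult_r, H3; induction j as [|j IH]; simpl; [reflexivity|rewrite IH; ring].
Qed.

(** For a primitive cube root [w], [1 + w^k + w^(2k)] is [3] or [0] according to whether [3] divides
    [k]; the bound [3 * n] keeps the blocks of three complete. *)
Lemma cube_root_filter (b : C) (n : nat) :
  csum (bc b) (3 * n)
  + csum (fun k => bc b k * cube_root 1 ^ k) (3 * n)
  + csum (fun k => bc b k * cube_root (-1) ^ k) (3 * n)
  = 3 * csum (fun j => bc b (3 * j)) n.
Proof.
rewrite !csum_mod3, <- !csum_plus, <- csum_scal; apply csum_ext; intros k _.
assert (E1 := cube_root_sqr 1 (or_introl eq_refl)).
assert (E2 := cube_root_sqr (-1) (or_intror eq_refl)).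
assert (E : cube_root (-1) = - (1) - cube_root 1).
{ unfold cube_root, Cminus, Cplus, Copp, RtoC; simpl; f_equal; field. }
rewrite !Cpow_add_r, !cube_root_pow3, !E1, !E2, !Cpow_1_r, E by auto; ring.
Qed.

(** * Every third coefficient: the closed form of the series *)

(** The value of [u (b / 3)], kept as a sum of two exponentials because it is to be differentiated
    in [b]. *)
Definition usum_lim (b : C) : C :=
  / 3 * (Cexp (- (b * root_log 1)) + Cexp (- (b * root_log (-1)))).

Lemma C3_neq_0 : RtoC 3 <> 0.
Proof. intros E; apply RtoC_inj in E; lra. Qed.

Lemma cvg_bc_mod3 (b : C) :
  (Re b < 0)%R -> cvg (csum (fun j => bc b (3 * j))) (usum_lim b).
Proof.
intros Hb; pose proof C3_neq_0.
pose proof (cvg_plus _ _ _ _ (cvg_plus _ _ _ _ (cvg_csum_bc b Hb)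
  (cvg_bc_cube_root b 1 Hb (or_introl eq_refl)))
  (cvg_bc_cube_root b (-1) Hb (or_intror eq_refl))) as HC.
apply (cvg_subseq _ _ (fun n => 3 * n)%nat) in HC; [|intros; lia].
apply (cvg_scal _ (/ 3)) in HC.
rewrite Cplus_0_l in HC.
revert HC; apply cvg_ext; intros n; rewrite cube_root_filter; field; auto.
Qed.

(** Triplication of Pochhammer symbols: the numerator is [(3a)_(3j) / 27^j] and the denominator
    [(3j)! / 27^j]. The induction matches one step of [u_term] with three steps of [bc]. *)
Lemma u_term_bc (a : C) (j : nat) : u_term a j = bc (3 * a) (3 * j).
Proof.
assert (H13 : forall (x : R) (k : nat), (0 < x)%R -> RtoC x + RtoC (INR k) <> 0).
{ intros x k Hx; rewrite <- RtoC_plus; intros E; apply RtoC_inj in E.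
  pose proof (pos_INR k); lra. }
assert (Hx1 : RtoC 1 / 3 = RtoC (1 / 3)) by (rewrite RtoC_div; [reflexivity|lra]).
assert (Hx2 : RtoC 2 / 3 = RtoC (2 / 3)) by (rewrite RtoC_div; [reflexivity|lra]).
unfold u_term, term3F2; induction j as [|j IH].
- rewrite Nat.mul_0_r, bc_0; simpl; field.
- replace (3 * S j)%nat with (S (S (S (3 * j)))) by lia.
  rewrite !bc_succ, <- IH.
  change (fact (S j)) with (S j * fact j)%nat; cbn [pochhammer].
  assert (P1 : pochhammer (1 / 3) j <> 0).
  { apply pochhammer_neq_0; intros k _; rewrite Hx1; apply H13; lra. }
  assert (P2 : pochhammer (2 / 3) j <> 0).
  { apply pochhammer_neq_0; intros k _; rewrite Hx2; apply H13; lra. }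
  assert (P3 := RtoC_fact_neq_0 j).
  rewrite mult_INR, RtoC_mult, !RtoC_INR_S.
  replace (RtoC (INR (3 * j))) with (3 * RtoC (INR j)).
  2:{ rewrite mult_INR, RtoC_mult; f_equal; f_equal; simpl; ring. }
  assert (Q1 : 3 * RtoC (INR j) + 1 <> 0).
  { rewrite <- RtoC_mult, <- RtoC_plus; intros E; apply RtoC_inj in E; pose proof (pos_INR j); lra. }
  assert (Q2 : 3 * RtoC (INR j) + 1 + 1 <> 0).
  { rewrite <- RtoC_mult, <- !RtoC_plus; intros E; apply RtoC_inj in E; pose proof (pos_INR j); lra. }
  assert (Q2' : 3 * RtoC (INR j) + 2 <> 0).
  { rewrite <- RtoC_mult, <- !RtoC_plus; intros E; apply RtoC_inj in E; pose proof (pos_INR j); lra. }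
  assert (Q3 : RtoC (INR j) + 1 <> 0).
  { rewrite <- !RtoC_plus; intros E; apply RtoC_inj in E; pose proof (pos_INR j); lra. }
  assert (Q3' : 3 * RtoC (INR j) + 1 + 1 + 1 <> 0).
  { rewrite <- RtoC_mult, <- !RtoC_plus; intros E; apply RtoC_inj in E; pose proof (pos_INR j); lra. }
  pose proof C3_neq_0 as T3.
  set (A := pochhammer a j); set (B := pochhammer (a + 1 / 3) j);
  set (D := pochhammer (a + 2 / 3) j); set (x := RtoC (INR j)) in *;
  set (E1 := pochhammer (1 / 3) j) in *; set (E2 := pochhammer (2 / 3) j) in *.
  assert (Z1 : 1 / 3 + x = (3 * x + 1) / 3) by (field; auto).
  assert (Z2 : 2 / 3 + x = (3 * x + 2) / 3) by (field; auto).
  rewrite Z1, Z2.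
  replace (3 * x + 1 + 1) with (3 * x + 2) in * by ring.
  replace (3 * x + 2 + 1) with (3 * (x + 1)) in * by ring.
  field; repeat split; auto.
Qed.

Lemma cvg_u_term (a : C) : (Re a < 0)%R -> cvg (csum (u_term a)) (usum_lim (3 * a)).
Proof.
intros Ha; apply (cvg_ext (csum (fun j => bc (3 * a) (3 * j)))).
- intros n; apply csum_ext; intros j _; symmetry; apply u_term_bc.
- apply cvg_bc_mod3; destruct a; simpl in *; lra.
Qed.

(** * Differentiation of the series in the parameter *)

(** The multipliers are the indices [k], so [c * w k] is at most a telescoping difference. The bound
    involves only the term of index [N], which makes it uniform in parameters. *)
Lemma kummer_sum (w : nat -> R) (c : R) (N n : nat) :
  (forall k, 0 <= w k)%R ->
  (forall k, (N <= k)%nat -> (c * w k <= INR k * w k - INR (S k) * w (S k))%R) ->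
  (N <= n)%nat -> (c * (rsum w n - rsum w N) + INR n * w n <= INR N * w N)%R.
Proof.
intros Hw Hk; induction 1 as [|n Hn IH]; [lra|].
specialize (Hk n Hn); simpl rsum; lra.
Qed.

Definition T1 (b : C) (n : nat) : R := rsum (fun k => / Cmod (b + RtoC (INR k)))%R n.

(** Twice this bounds the second derivative in [b] of [bc b n], because [T1] dominates [S1] and its
    square dominates [S2]. A large enough [K] makes Kummer's test work in spite of the growth of
    [T1]. *)
Definition bc_weight (K : R) (b : C) (n : nat) : R := (Cmod (bc b n) * (K + T1 b n)²)%R.

Lemma Rinv_ge_0 (x : R) : (0 <= x -> 0 <= / x)%R.
Proof.
intros [H|H]; [now apply Rlt_le, Rinv_0_lt_compat|rewrite <- H, Rinv_0; lra].
Qed.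

Lemma T1_ge_0 (b : C) (n : nat) : (0 <= T1 b n)%R.
Proof. apply rsum_ge_0; intros k; apply Rinv_ge_0, Cmod_ge_0. Qed.

Lemma bc_weight_ge_0 (K : R) (b : C) (n : nat) : (0 <= bc_weight K b n)%R.
Proof. apply Rmult_le_pos; [apply Cmod_ge_0|apply Rle_0_sqr]. Qed.

(** With [m = Cmod (b + n) <= n - c] and [S = 1 + 6 / c + T1 b n], one has [m (S + 1/m)^2 = m S^2 +
    2 S + 1/m <= (n - c) S^2 + 3 S], and [3 S <= (c / 2) S^2] as soon as [6 <= c S]. The summand
    [6 / c] secures the latter, the summand [1] secures [1/m <= S]. *)
Lemma bc_weight_step (b : C) (c R0 : R) (n : nat) :
  (0 < c)%R -> (Re b <= - 2 * c)%R -> (Cmod b <= R0)%R ->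
  (R0 * R0 / (2 * c) + c <= INR n)%R -> (R0 + 1 <= INR n)%R ->
  (c / 2 * bc_weight (1 + 6 / c) b n
   <= INR n * bc_weight (1 + 6 / c) b n - INR (S n) * bc_weight (1 + 6 / c) b (S n))%R.
Proof.
intros Hc Hre HR Hn HnR; unfold bc_weight.
rewrite <- (Rmult_assoc (INR (S n))), (bc_step b n); unfold T1; simpl rsum; fold (T1 b n).
pose proof (Cmod_shift_le b c R0 (INR n) Hc Hre HR Hn) as Hm.
assert (Hm1 : (1 <= Cmod (b + RtoC (INR n)))%R).
{ pose proof (Cmod_triangle_inv (RtoC (INR n)) (- b)) as H.
  replace (RtoC (INR n) - - b) with (b + RtoC (INR n)) in H by ring.
  rewrite Cmod_opp, Cmod_R, Rabs_pos_eq in H by apply pos_INR; lra. }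
set (m := Cmod (b + RtoC (INR n))) in *.
assert (HS : (1 + 6 / c <= 1 + 6 / c + T1 b n)%R) by (pose proof (T1_ge_0 b n); lra).
rewrite <- (Rplus_assoc (1 + 6 / c)).
set (S := (1 + 6 / c + T1 b n)%R) in *.
assert (H6 : (0 < 6 / c)%R) by (apply Rdiv_lt_0_compat; lra).
assert (HcS : (6 <= c * S)%R).
{ replace 6%R with (c * (6 / c))%R at 1 by (field; lra); apply Rmult_le_compat_l; lra. }
pose proof (Cmod_ge_0 (bc b n)) as HB; set (B := Cmod (bc b n)) in *.
assert (HE : (m * (S + / m)² <= (INR n - c / 2) * S²)%R).
{ replace (m * (S + / m)²)%R with (m * S² + 2 * S + / m)%R by (unfold Rsqr; field; lra).
  assert (/ m <= 1)%R by (rewrite <- Rinv_1; apply Rinv_le_contravar; lra).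
  unfold Rsqr.
  assert (H1 : (m * (S * S) <= (INR n - c) * (S * S))%R) by (apply Rmult_le_compat_r; nra).
  assert (H2 : (6 * S <= c * S * S)%R) by (apply Rmult_le_compat_r; lra).
  lra. }
replace (m * B * (S + / m)²)%R with (B * (m * (S + / m)²))%R by ring.
assert (HBE := Rmult_le_compat_l B _ _ HB HE).
lra.
Qed.

(** Deliberately crude: it only has to control finitely many initial terms uniformly in [b]. *)
Lemma Cmod_pochhammer_le (b : C) (R0 : R) (n : nat) :
  (Cmod b <= R0)%R -> (Cmod (pochhammer b n) <= (R0 + INR n) ^ n)%R.
Proof.
intros HR; pose proof (Cmod_ge_0 b) as Hb; induction n as [|n IH]; [simpl; rewrite Cmod_1; lra|].
cbn [pochhammer]; rewrite Cmod_mult, S_INR, <- tech_pow_Rmult, Rmult_comm.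
pose proof (pos_INR n) as Hn.
apply Rmult_le_compat; try apply Cmod_ge_0.
- eapply Rle_trans; [apply Cmod_triangle|]; rewrite Cmod_R, Rabs_pos_eq by auto; lra.
- eapply Rle_trans; [exact IH|]; apply pow_incr; lra.
Qed.

Lemma Cmod_bc_le (b : C) (R0 : R) (n : nat) :
  (Cmod b <= R0)%R -> (Cmod (bc b n) <= (R0 + INR n) ^ n)%R.
Proof.
intros HR; unfold bc; rewrite Cmod_div by apply RtoC_fact_neq_0.
rewrite Cmod_R, Rabs_pos_eq by apply pos_INR.
assert (H1 : (1 <= INR (fact n))%R) by (apply (le_INR 1), lt_O_fact).
pose proof (Cmod_pochhammer_le b R0 n HR) as H; pose proof (Cmod_ge_0 (pochhammer b n)).
apply Rle_div_l; nra.
Qed.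

Lemma T1_le (b : C) (d : R) (n : nat) :
  (0 < d)%R -> (forall k, d <= Cmod (b + RtoC (INR k))%C)%R -> (T1 b n <= INR n / d)%R.
Proof.
intros Hd Hk; induction n as [|n IH]; [unfold T1; simpl; lra|].
unfold T1 in *; cbn [rsum]; rewrite S_INR.
assert (/ Cmod (b + RtoC (INR n)) <= / d)%R by (apply Rinv_le_contravar; auto).
unfold Rdiv in *; lra.
Qed.

Lemma bc_weight_le (b : C) (K R0 d : R) (n : nat) :
  (0 <= K)%R -> (0 < d)%R -> (Cmod b <= R0)%R ->
  (forall k, d <= Cmod (b + RtoC (INR k))%C)%R ->
  (bc_weight K b n <= (R0 + INR n) ^ n * (K + INR n / d)²)%R.
Proof.
intros HK Hd HR Hk; apply Rmult_le_compat.
- apply Cmod_ge_0.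
- apply Rle_0_sqr.
- now apply Cmod_bc_le.
- pose proof (T1_ge_0 b n); pose proof (T1_le b d n Hd Hk).
  apply Rsqr_incr_1; lra.
Qed.

(** The threshold of [bc_weight_step] depends only on [c] and [R0]; Kummer's test handles the tail
    and the crude majorant [W] the initial terms, both uniformly in [b]. *)
Lemma bc_weight_summable (c R0 d : R) :
  (0 < c)%R -> (0 <= R0)%R -> (0 < d)%R ->
  exists M, forall b n, (Re b <= - 2 * c)%R -> (Cmod b <= R0)%R ->
    (forall k, d <= Cmod (b + RtoC (INR k))%C)%R ->
    (rsum (bc_weight (1 + 6 / c) b) n <= M)%R.
Proof.
intros Hc HR0 Hd; set (K := (1 + 6 / c)%R).
assert (HK : (0 <= K)%R).
{ unfold K; assert (0 < 6 / c)%R by (apply Rdiv_lt_0_compat; lra); lra. }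
assert (Hq : (0 <= R0 * R0 / (2 * c) + c + R0 + 1)%R).
{ assert (0 <= R0 * R0 / (2 * c))%R by (apply Rdiv_le_0_compat; nra); lra. }
destruct (nfloor_ex _ Hq) as [N HN].
set (W := fun n => ((R0 + INR n) ^ n * (K + INR n / d)²)%R).
exists (rsum W (S N) + 2 / c * (INR (S N) * W (S N)))%R.
intros b n Hre HR Hk.
assert (HW : forall n, (bc_weight K b n <= W n)%R) by (intros m; now apply bc_weight_le).
pose proof (bc_weight_ge_0 K b) as Hw0.
(* Since [n] may lie below the threshold, the sum is extended to [n + S N], which covers both
   cases. *)
assert (Hn : (rsum (bc_weight K b) n <= rsum (bc_weight K b) (n + S N))%R)
  by (apply rsum_incr; auto; lia).
assert (HKum : (c / 2 * (rsum (bc_weight K b) (n + S N) - rsum (bc_weight K b) (S N))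
   + INR (n + S N) * bc_weight K b (n + S N) <= INR (S N) * bc_weight K b (S N))%R).
{ apply kummer_sum; auto; [|lia].
  intros k HkN; apply (bc_weight_step b c R0); auto;
    apply le_INR in HkN; rewrite S_INR in HkN; pose proof (pos_INR N);
    assert (0 <= R0 * R0 / (2 * c))%R by (apply Rdiv_le_0_compat; nra); lra. }
assert (H1 : (rsum (bc_weight K b) (S N) <= rsum W (S N))%R) by (apply rsum_le; auto).
assert (H2 : (INR (S N) * bc_weight K b (S N) <= INR (S N) * W (S N))%R)
  by (apply Rmult_le_compat_l; auto; apply pos_INR).
assert (H3 : (0 <= INR (n + S N) * bc_weight K b (n + S N))%R)
  by (apply Rmult_le_pos; auto; apply pos_INR).
assert (H4 : (rsum (bc_weight K b) (n + S N) - rsum (bc_weight K b) (S N)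
   <= 2 / c * (INR (S N) * W (S N)))%R).
{ replace (rsum (bc_weight K b) (n + S N) - rsum (bc_weight K b) (S N))%R with
    (2 / c * (c / 2 * (rsum (bc_weight K b) (n + S N) - rsum (bc_weight K b) (S N))))%R
    by (field; lra).
  apply Rmult_le_compat_l; [apply Rlt_le, Rdiv_lt_0_compat; lra|lra]. }
lra.
Qed.

Lemma Cmod_S1_le (b : C) (n : nat) :
  (forall k, b + RtoC (INR k) <> 0) -> (Cmod (S1 b n) <= T1 b n)%R.
Proof.
intros Hk; apply Cmod_csum_le; intros k _; rewrite Cmod_inv by auto; lra.
Qed.

(** A sum of squares of nonnegative numbers is at most the square of their sum. *)
Lemma Cmod_S2_le (b : C) (n : nat) :
  (forall k, b + RtoC (INR k) <> 0) -> (Cmod (S2 b n) <= (T1 b n)²)%R.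
Proof.
intros Hk; induction n as [|n IH].
- unfold S2; simpl; rewrite Cmod_0; apply Rle_0_sqr.
- change (S2 b (S n)) with (S2 b n + / ((b + RtoC (INR n)) * (b + RtoC (INR n)))).
  change (T1 b (S n)) with (T1 b n + / Cmod (b + RtoC (INR n)))%R.
  eapply Rle_trans; [apply Cmod_triangle|].
  rewrite Cmod_inv, Cmod_mult, Rinv_mult by (apply Cmult_neq_0; auto).
  pose proof (T1_ge_0 b n); pose proof (Rinv_ge_0 _ (Cmod_ge_0 (b + RtoC (INR n)))).
  unfold Rsqr in *; nra.
Qed.

Lemma cderiv_bc (b : C) (n : nat) :
  (forall k, b + RtoC (INR k) <> 0) -> cderiv (fun y => bc y n) b (bc b n * S1 b n).
Proof.
intros Hk; unfold bc.
apply (cderiv_ext (fun y => / RtoC (INR (fact n)) * pochhammer y n)).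
- intros y; unfold Cdiv; ring.
- replace (pochhammer b n / RtoC (INR (fact n)) * S1 b n) with
    (/ RtoC (INR (fact n)) * (pochhammer b n * S1 b n)) by (unfold Cdiv; ring).
  apply cderiv_scal, cderiv_pochhammer; auto.
Qed.

Lemma rsum_mod3_le (f : nat -> R) (n : nat) :
  (forall k, 0 <= f k)%R -> (rsum (fun j => f (3 * j)%nat) n <= rsum f (3 * n))%R.
Proof.
intros Hf; induction n as [|n IH]; [simpl; lra|].
replace (3 * S n)%nat with (S (S (S (3 * n)))) by lia; cbn [rsum].
pose proof (Hf (S (3 * n))); pose proof (Hf (S (S (3 * n)))); lra.
Qed.

(** Finitely many nonzero moduli have a positive lower bound, and for [k >= Cmod b + 1] the modulus
    is at least [1]. *)
Lemma shift_bounded_below (b : C) :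
  (forall k, b + RtoC (INR k) <> 0) ->
  exists d, (0 < d)%R /\ forall k, (d <= Cmod (b + RtoC (INR k))%C)%R.
Proof.
intros Hk.
assert (Hfin : forall N, exists d, (0 < d)%R /\
  forall k, (k < N)%nat -> (d <= Cmod (b + RtoC (INR k)))%R).
{ induction N as [|N [d [Hd IH]]]; [exists 1%R; split; [lra|intros; lia]|].
  exists (Rmin d (Cmod (b + RtoC (INR N)))); split.
  - apply Rmin_pos; auto; now apply Cmod_gt_0.
  - intros k HkN; destruct (Nat.eq_dec k N) as [->|Hne]; [apply Rmin_r|].
    eapply Rle_trans; [apply Rmin_l|apply IH; lia]. }
destruct (nfloor_ex (Cmod b) (Cmod_ge_0 b)) as [N HN].
destruct (Hfin (S (S N))) as [d [Hd HdN]].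
exists (Rmin d 1); split; [apply Rmin_pos; lra|].
intros k; destruct (Nat.lt_ge_cases k (S (S N))) as [H|H].
- eapply Rle_trans; [apply Rmin_l|auto].
- eapply Rle_trans; [apply Rmin_r|].
  apply le_INR in H; rewrite !S_INR in H.
  pose proof (Cmod_triangle_inv (RtoC (INR k)) (- b)) as Ht.
  replace (RtoC (INR k) - - b) with (b + RtoC (INR k)) in Ht by ring.
  rewrite Cmod_opp, Cmod_R, Rabs_pos_eq in Ht by apply pos_INR; lra.
Qed.

(** * Exchange of summation and differentiation *)

Definition dusum_lim (b : C) : C :=
  / 3 * (- root_log 1 * Cexp (- (b * root_log 1))
         + - root_log (-1) * Cexp (- (b * root_log (-1)))).

Lemma cderiv_usum_lim (b : C) : cderiv usum_lim b (dusum_lim b).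
Proof.
assert (H : forall l, cderiv (fun y => Cexp (- (y * l))) b (- l * Cexp (- (b * l)))).
{ intros l; replace (- (b * l)) with (- l * b) by ring.
  apply (cderiv_ext (fun y => Cexp (- l * y))); [intros; f_equal; ring|].
  apply cderiv_Cexp_scal. }
apply cderiv_scal, (cderiv_plus (fun y => Cexp (- (y * root_log 1)))); apply H.
Qed.

Lemma cvg_dbc_mod3 (b : C) :
  (Re b < 0)%R -> (forall k, b + RtoC (INR k) <> 0) ->
  cvg (csum (fun j => bc b (3 * j) * S1 b (3 * j))) (dusum_lim b).
Proof.
intros Hb Hk.
destruct (shift_bounded_below b Hk) as [d [Hd Hdk]].
(* Within distance [2 * c] of [b] the real part stays below [Re b + 2 * c = - 2 * c], as the Kummer
   bound requires; within [d / 2] every [y + k] stays at distance at least [d / 2] from [0]. *)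
set (c := (- Re b / 4)%R); assert (Hc : (0 < c)%R) by (unfold c; lra).
set (r := Rmin (d / 2) (2 * c)).
assert (Hr : (0 < r)%R) by (apply Rmin_pos; lra).
pose proof (Rmin_l (d / 2) (2 * c)) as Hr1; pose proof (Rmin_r (d / 2) (2 * c)) as Hr2.
fold r in Hr1, Hr2.
set (R0 := (Cmod b + r)%R).
assert (HR0 : (0 <= R0)%R) by (unfold R0; pose proof (Cmod_ge_0 b); lra).
destruct (bc_weight_summable c R0 (d / 2) Hc HR0 ltac:(lra)) as [M HM].
assert (Hball : forall y, (Cmod (y - b) < r)%R ->
  (Re y <= - 2 * c)%R /\ (Cmod y <= R0)%R
  /\ (forall k, d / 2 <= Cmod (y + RtoC (INR k))%C)%R).
{ intros y Hy; split; [|split].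
  - pose proof (re_le_Cmod (y - b)) as H; unfold c in *; destruct b as [b1 b2], y as [y1 y2];
    simpl in *; apply Rabs_le_between in H; lra.
  - unfold R0; pose proof (Cmod_triangle_inv y b); lra.
  - intros k; specialize (Hdk k).
    pose proof (Cmod_triangle_inv (b + RtoC (INR k)) (y + RtoC (INR k))) as Ht.
    replace (b + RtoC (INR k) - (y + RtoC (INR k))) with (- (y - b)) in Ht by ring.
    rewrite Cmod_opp in Ht; lra. }
apply (cvg_cderiv (fun n y => csum (fun j => bc y (3 * j)) n)
  (fun n y => csum (fun j => bc y (3 * j) * S1 y (3 * j)) n)
  (fun n y => csum (fun j => bc y (3 * j)
     * (S1 y (3 * j) * S1 y (3 * j) + - S2 y (3 * j))) n) usum_lim b _ r (2 * M)); auto.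
- intros n y Hy; destruct (Hball y Hy) as (Hy1 & Hy2 & Hy3).
  assert (Hyk : forall k, y + RtoC (INR k) <> 0).
  { intros k; apply Cmod_gt_0; specialize (Hy3 k); lra. }
  split; [|split].
  + apply (cderiv_csum (fun j y => bc y (3 * j)) (fun j y => bc y (3 * j) * S1 y (3 * j))).
    intros j _; now apply cderiv_bc.
  + apply (cderiv_csum (fun j y => bc y (3 * j) * S1 y (3 * j))
      (fun j y => bc y (3 * j) * (S1 y (3 * j) * S1 y (3 * j) + - S2 y (3 * j)))).
    intros j _; apply (cderiv_log_second (fun y => bc y (3 * j)) (fun y => S1 y (3 * j))).
    * now apply cderiv_bc.
    * apply cderiv_S1; auto.
  (* [S1^2] and [S2] are each at most [T1^2] in modulus, whence the factor [2]; passing to multiples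
     of [3] only drops nonnegative terms. *)
  + apply Rle_trans with (rsum (fun j => 2 * bc_weight (1 + 6 / c) y (3 * j))%R n).
    * apply Cmod_csum_le; intros j _; rewrite Cmod_mult; unfold bc_weight.
      set (T := T1 y (3 * j)).
      assert (HT : (0 <= T)%R) by apply T1_ge_0.
      assert (HK : (0 < 6 / c)%R) by (apply Rdiv_lt_0_compat; lra).
      replace (2 * (Cmod (bc y (3 * j)) * (1 + 6 / c + T)²))%R with
        (Cmod (bc y (3 * j)) * (2 * (1 + 6 / c + T)²))%R by ring.
      apply Rmult_le_compat_l; [apply Cmod_ge_0|].
      eapply Rle_trans; [apply Cmod_triangle|]; rewrite Cmod_opp, Cmod_mult.
      pose proof (Cmod_S1_le y (3 * j) Hyk) as B1; pose proof (Cmod_S2_le y (3 * j) Hyk) as B2.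
      pose proof (Cmod_ge_0 (S1 y (3 * j))) as B3; fold T in B1, B2.
      assert (B4 : (T² <= (1 + 6 / c + T)²)%R) by (apply Rsqr_incr_1; lra).
      unfold Rsqr in *; nra.
    * rewrite rsum_scal; apply Rmult_le_compat_l; [lra|].
      eapply Rle_trans; [apply rsum_mod3_le; apply bc_weight_ge_0|].
      now apply HM.
- intros y Hy; destruct (Hball y Hy) as (Hy1 & _); apply cvg_bc_mod3; lra.
- apply cderiv_usum_lim.
Qed.

(** The arguments [3 (j + a)] and [3 a] differ by the integer [3 j], so the digamma difference is a
    finite sum. *)
Lemma du_term_bc (a : C) (j : nat) :
  (forall k, 3 * a + RtoC (INR k) <> 0) ->
  du_term a j = bc (3 * a) (3 * j) * S1 (3 * a) (3 * j).
Proof.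
intros Hk; unfold du_term; rewrite u_term_bc.
replace (3 * (RtoC (INR j) + a)) with (3 * a + RtoC (INR (3 * j))).
- rewrite digamma_add_nat by auto; ring.
- rewrite mult_INR, RtoC_mult; replace (INR 3) with 3%R by (simpl; ring); ring.
Qed.

Lemma cvg_du_term (a : C) :
  (Re a < 0)%R -> (forall k, 3 * a + RtoC (INR k) <> 0) ->
  cvg (csum (du_term a)) (dusum_lim (3 * a)).
Proof.
intros Ha Hk; apply (cvg_ext (csum (fun j => bc (3 * a) (3 * j) * S1 (3 * a) (3 * j)))).
- intros n; apply csum_ext; intros j _; symmetry; now apply du_term_bc.
- apply cvg_dbc_mod3; auto; destruct a; simpl in *; lra.
Qed.

(** [u] coincides with its closed form on the ball of radius [- Re a], which lies in the left
    half-plane, so the derivative is read off from that form. *)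
Lemma cderiv_u (a : C) : (Re a < 0)%R -> cderiv u a (3 * dusum_lim (3 * a)).
Proof.
intros Ha; apply (cderiv_ext_loc (fun y => usum_lim (3 * y)) _ _ _ (- Re a)); [lra| |].
- intros y Hy; symmetry; apply cvg_CSeries, cvg_u_term.
  pose proof (re_le_Cmod (y - a)) as H; destruct a as [a1 a2], y as [y1 y2]; simpl in *.
  apply Rabs_le_between in H; lra.
- replace (3 * dusum_lim (3 * a)) with (3 * 1 * dusum_lim (3 * a)) by ring.
  apply (cderiv_comp (fun y => 3 * y)); [apply cderiv_scal, cderiv_id|apply cderiv_usum_lim].
Qed.

(** * The trigonometric form of the derivative *)

(** In terms of [q = 3^(-3a/2)] and [p = exp (i pi a / 2)] the exponentials, sine and cosine become
    rational, and the identity is algebraic up to [Ci * Ci = - (1)]. *)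
Lemma dusum_lim_closed_form (a : C) :
  3 * dusum_lim (3 * a) =
    - (RCpower 3 (- (3 * a / 2) - 1)
       * (RtoC PI * Csin (RtoC PI * a / 2)
          + Ccos (RtoC PI * a / 2) * RtoC (ln 27))).
Proof.
pose proof C3_neq_0 as H3.
assert (H2 : RtoC 2 <> 0) by (intros E; apply RtoC_inj in E; lra).
assert (H6 : RtoC 6 <> 0) by (intros E; apply RtoC_inj in E; lra).
assert (HCi : Ci * Ci = - (1)) by (unfold Ci, Cmult, Copp, RtoC; simpl; f_equal; ring).
assert (HCi0 : Ci <> 0).
{ intros E; rewrite E in HCi; apply C1_nz; transitivity (- - (1)); [ring|rewrite <- HCi; ring]. }
assert (Hlog : forall s : R, root_log s
  = RtoC (ln 3) / 2 - Ci * (RtoC s * (RtoC PI / 6))).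
{ intros s; rewrite <- !RtoC_div, <- !RtoC_mult by lra.
  unfold root_log, Ci, RtoC, Cminus, Cplus, Copp, Cmult; simpl; f_equal; ring. }
assert (Hm1 : RtoC (-1) = - (1)) by (unfold RtoC, Copp; simpl; f_equal; ring).
set (q := Cexp (- (3 * a / 2) * RtoC (ln 3))).
set (p := Cexp (Ci * (RtoC PI * a / 2))).
assert (Hp : p <> 0) by apply Cexp_neq_0.
assert (E1 : Cexp (- (3 * a * root_log 1)) = q * p).
{ unfold p, q; rewrite <- Cexp_plus, Hlog; f_equal; field; auto. }
assert (E2 : Cexp (- (3 * a * root_log (-1))) = q * / p).
{ unfold p, q; rewrite <- Cexp_opp, <- Cexp_plus, Hlog, Hm1; f_equal; field; auto. }
assert (E3 : RCpower 3 (- (3 * a / 2) - 1) = q / 3).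
{ unfold RCpower, q.
  replace ((- (3 * a / 2) - 1) * RtoC (ln 3)) with
    (- (3 * a / 2) * RtoC (ln 3) + - RtoC (ln 3)) by ring.
  rewrite Cexp_plus, Cexp_opp, Cexp_RtoC, exp_ln by lra; reflexivity. }
assert (E4 : ln 27 = (3 * ln 3)%R).
{ replace 27%R with (3 * (3 * 3))%R by ring; rewrite !ln_mult by lra; ring. }
unfold dusum_lim; rewrite E1, E2, E3, E4, RtoC_mult.
unfold Csin, Ccos; rewrite Cexp_opp; fold p.
rewrite !Hlog, Hm1.
(* [field] treats [Ci] as a free symbol, so it is moved out of the denominator of the sine
   beforehand. *)
replace (RtoC PI * ((p - / p) / (2 * Ci))) with (- Ci * RtoC PI * (p - / p) / 2).
2:{ transitivity (- (Ci * Ci) * (RtoC PI * ((p - / p) / (2 * Ci)))).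
    - field; repeat split; auto.
    - rewrite HCi; ring. }
field; repeat split; auto.
Qed.

Theorem mainTheorem5 :
  (forall a : C, (Re a < 0)%R ->
     ex_series (K := C_AbsRing) (V := C_NormedModule) (u_term a)) /\
  (forall a : C, (Re a < 0)%R ->
     (forall n : nat, (1 <= n)%nat -> 3 * a <> - RtoC (INR n)) ->
     ex_series (K := C_AbsRing) (V := C_NormedModule) (du_term a) /\
     is_derive (K := C_AbsRing) (V := C_NormedModule) u a
       (3 * CSeries (du_term a)) /\
     3 * CSeries (du_term a) =
       - (RCpower 3 (- (3 * a / 2) - 1)
          * (RtoC PI * Csin (RtoC PI * a / 2)
             + Ccos (RtoC PI * a / 2) * RtoC (ln 27)))).
Proof.
split.
- intros a Ha; exact (cvg_ex_series _ _ (cvg_u_term a Ha)).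
- intros a Ha Hn.
  assert (Hk : forall k, 3 * a + RtoC (INR k) <> 0).
  (* The hypothesis excludes [3 * a = - n] for [n >= 1]; the case [k = 0] is settled by
     [Re a < 0]. *)
  { intros [|k] E.
    - apply (f_equal Re) in E; destruct a; simpl in *; lra.
    - apply (Hn (S k)); [lia|].
      replace (3 * a) with (3 * a + RtoC (INR (S k)) - RtoC (INR (S k))) by ring.
      rewrite E; ring. }
  pose proof (cvg_du_term a Ha Hk) as Hdu.
  rewrite (cvg_CSeries _ _ Hdu); split; [|split].
  + exact (cvg_ex_series _ _ Hdu).
  + apply cderiv_is_derive, cderiv_u, Ha.
  + apply dusum_lim_closed_form.
Qed.
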